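(* Let $p\ge1$ be an integer, let $A=(a_{ij})_{1\le i,j\le p}$ be a square matrix of complex numbers, and let $S=(S_i)_{1\le i\le p}\in(\mathcal{D}')^p$. If all $S_i$, $1\le i\le p$, are almost automorphic distributions and the matrix $A$ has no eigenvalues with real part zero, then the equation $$U'=AU+S$$ admits a unique solution $U=(U_i)_{1\le i\le p}\in(\mathcal{D}'_{L^\infty})^p$, and this solution is an almost automorphic vector distribution, i.e. $U\in(\mathcal{B}'_{aa})^p$.
   Context: All functions and distributions are complex-valued and defined on $\mathbb{R}$; $\mathcal{D}$ is the space of smooth compactly supported functions and $\mathcal{D}'$ the space of distributions. Derivatives are distributional. A continuous function $f:\mathbb{R}\to\mathbb{C}$ is almost automorphic if for every real sequence $(s_m)_{m\in\mathbb{N}}$ there is a subsequence $(s_{m_k})_k$ such that $g(x):=\lim_{k\to+\infty}f(x+s_{m_k})$ is well-defined for every $x\in\mathbb{R}$ and $\lim_{k\to+\infty}g(x-s_{m_k})=f(x)$ for every $x\in\mathbb{R}$. $\mathcal{C}_{aa}$ denotes the space of almost automorphic functions. $\mathcal{D}_{L^1}=\{\varphi\in\mathcal{C}^\infty:\ \varphi^{(i)}\in L^1\ \forall i\in\mathbb{Z}_+\}$ is a Fréchet space for the norms $|\varphi|_{m,1}=\sum_{i=0}^m\|\varphi^{(i)}\|_{L^1}$, $m\in\mathbb{Z}_+$, and $\mathcal{D}$ is dense in it. $\mathcal{D}'_{L^\infty}$ is the topological dual of $\mathcal{D}_{L^1}$, regarded as a subspace of $\mathcal{D}'$; its elements are called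 bounded distributions. For $\varphi\in\mathcal{D}$, $(T\ast\varphi)(x)=\langle T,\varphi(x-\cdot)\rangle$. A distribution $T\in\mathcal{D}'_{L^\infty}$ is called almost automorphic if it satisfies either of the following equivalent conditions: (i) $T\ast\varphi\in\mathcal{C}_{aa}$ for all $\varphi\in\mathcal{D}$; (ii) $T=\sum_{j=0}^kf_j^{(j)}$ for some $k\in\mathbb{Z}_+$ and $f_0,\dots,f_k\in\mathcal{C}_{aa}$ (distributional derivatives). $\mathcal{B}'_{aa}$ is the space of almost automorphic distributions. *)

(* Defs.v *)
From HB Require Import structures.
From mathcomp Require Import all_boot all_order all_algebra.
From mathcomp Require Import all_classical all_reals all_analysis.
From mathcomp Require Import measurable_realfun.
From mathcomp Require Export complex.
From mathcomp Require Import ring lra.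

Set Implicit Arguments.
Unset Strict Implicit.
Unset Printing Implicit Defensive.

Import Order.TTheory GRing.Theory Num.Theory numFieldNormedType.Exports.

Local Open Scope ring_scope.
Local Open Scope classical_set_scope.

(* Rcomplex R is the library's copy of R[i] seen as a module over R; normed by
   the complex modulus, it provides the limits and the derivatives (with respect
   to the real variable) of functions from R to R[i]. *)
Section rcomplex_normed.
Variable R : realType.

Lemma Rcomplex_normrZ (l : R) (x : Rcomplex R) : `|l *: x| = `|l| * `|x|.
Proof.
case: x => a b; rewrite /Num.norm /=.
by rewrite !exprMn -mulrDr sqrtrM ?sqr_ge0// sqrtr_sqr.
Qed.

HB.instance Definition _ :=
  PseudoMetric.copy (Rcomplex R) (pseudoMetric_normed (Rcomplex R)).
HB.instance Definition _ := isPointed.Build (Rcomplex R) 0.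
HB.instance Definition _ :=
  NormedZmod_PseudoMetric_eq.Build R (Rcomplex R) erefl.
HB.instance Definition _ :=
  PseudoMetricNormedZmod_Lmodule_isNormedModule.Build R (Rcomplex R)
    Rcomplex_normrZ.

End rcomplex_normed.

Section complex_valued.
Variable R : realType.
Implicit Types f g : R -> Rcomplex R.

Definition smooth (f : R -> Rcomplex R) : Prop :=
  forall n x, derivable f^`(n) x 1.

Lemma Rcomplex_normrM (a b : Rcomplex R) : `|(a * b : Rcomplex R)| = `|a| * `|b|.
Proof. exact: Normc.normcM. Qed.

Lemma continuous_mulc (a : R[i]) :
  continuous (fun z : Rcomplex R => (a : Rcomplex R) * z : Rcomplex R).
Proof.
move=> z; apply/(@cvgrPdist_le _ _ _ (nbhs z)) => e e0.
have a1 : 0 < `|a : Rcomplex R| + 1 by rewrite ltr_wpDl.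
apply/(@nbhs_normP R (Rcomplex R)); exists (e / (`|a : Rcomplex R| + 1)) => /=.
  by rewrite divr_gt0.
move=> y /=; rewrite ltr_pdivlMr// mulrC => /ltW zy.
rewrite -mulrBr Rcomplex_normrM; apply: le_trans zy.
by rewrite ler_wpM2r// lerDl.
Qed.

Lemma is_derive_cvg f (x : R) l :
  h^-1 *: (f (h + x) - f x) @[h --> 0^'] --> l <-> is_derive x 1 f l.
Proof.
have E : (fun h : R => h^-1 *: ((f \o shift x) (h *: (1 : R)) - f x)) =
         (fun h => h^-1 *: (f (h + x) - f x)).
  by rewrite funeqE => h; rewrite /= /GRing.scale/= mulr1.
split=> [H|[H H']].
  split; first by rewrite /derivable E; apply/cvg_ex; exists l.
  by rewrite /derive E; apply/cvg_lim.
by rewrite -H' -E /derive; exact: H.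
Qed.

Lemma is_derive_mulc (a : R[i]) f (x : R) l : is_derive x 1 f l ->
  is_derive x 1 (fun y => (a : Rcomplex R) * f y : Rcomplex R)
    ((a : Rcomplex R) * l).
Proof.
move=> /is_derive_cvg H; apply/is_derive_cvg.
rewrite (_ : (fun h => _) = (fun z => (a : Rcomplex R) * z : Rcomplex R) \o
    (fun h : R => h^-1 *: (f (h + x) - f x))).
  exact: cvg_comp H (@continuous_mulc a l).
rewrite funeqE => h /=.
by rewrite -mulrBr mulrC scalerAl mulrC.
Qed.

Lemma derive1n_smooth_lin (a : R[i]) f g : smooth f -> smooth g ->
  forall n, (fun x => (a : Rcomplex R) * f x + g x : Rcomplex R)^`(n) =
            (fun x => (a : Rcomplex R) * derive1n n f x + derive1n n g x : Rcomplex R).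
Proof.
move=> sf sg; elim=> [//|n IH].
rewrite derive1nS IH funeqE => x; rewrite derive1E.
have h1 := is_derive_mulc a (derivableP (sf n x)).
have h2 := derivableP (sg n x).
have /@derive_val -> := is_deriveD h1 h2.
by rewrite !derive1nS !derive1E.
Qed.

Lemma smooth_lin (a : R[i]) f g : smooth f -> smooth g ->
  smooth (fun x => (a : Rcomplex R) * f x + g x : Rcomplex R).
Proof.
move=> sf sg n x; rewrite derive1n_smooth_lin//.
have h1 := is_derive_mulc a (derivableP (sf n x)).
by have /@ex_derive := is_deriveD h1 (derivableP (sg n x)).
Qed.

Lemma smooth_derive f : smooth f -> smooth f^`().
Proof. by move=> sf n x; rewrite -derive1Sn. Qed.

Lemma is_derive_reflect f (x t : R) : derivable f (x - t) 1 ->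
  is_derive t 1 (fun y => f (x - y)) (- derive1 f (x - t)).
Proof.
move=> /derivableP /is_derive_cvg H; apply/is_derive_cvg.
rewrite -derive1E in H.
rewrite (_ : (fun h => _) =
    (fun h => - (h^-1 *: (f (h + (x - t)) - f (x - t)))) \o -%R).
  apply: (@cvg_comp _ _ _ -%R _ _ (0^')); last exact: cvgN.
  have := @continuous_injective_withinNx R R -%R 0 (opp_continuous _).
  by rewrite oppr0; apply => y; rewrite -{1}oppr0 => /oppr_inj.
rewrite funeqE => h /=; rewrite invrN scaleNr opprK.
by rewrite (_ : x - (h + t) = - h + (x - t))//; ring.
Qed.

Lemma derive1n_reflect f (x : R) n : smooth f ->
  (fun y => f (x - y))^`(n) = (fun y => (-1) ^+ n *: derive1n n f (x - y)).
Proof.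
move=> sf; elim: n => [|n IH].
  by rewrite funeqE => y; rewrite expr0 scale1r.
rewrite derive1nS IH funeqE => y; rewrite derive1E.
have h := is_derive_reflect (sf n (x - y)).
have /@derive_val -> := is_deriveZ ((-1) ^+ n) h.
by rewrite -derive1nS exprS mulN1r scaleNr scalerN.
Qed.

Lemma smooth_reflect f (x : R) : smooth f -> smooth (fun y => f (x - y)).
Proof.
move=> sf n y; rewrite derive1n_reflect//.
have h := is_derive_reflect (sf n (x - y)).
by have /@ex_derive := is_deriveZ ((-1) ^+ n) h.
Qed.

Lemma smooth0 : smooth (fun=> 0).
Proof.
have E n : (fun=> 0 : Rcomplex R)^`(n) = (fun=> 0) :> (R -> Rcomplex R).
  elim: n => // n IH; rewrite derive1nS IH funeqE => x.
  by rewrite derive1_cst.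
by move=> n x; rewrite E; exact: derivable_cst.
Qed.

Lemma compact_supportP f : compact (closure [set x | f x != 0]) <->
  exists M : R, forall x, M < `|x| -> f x = 0.
Proof.
split=> [/compact_bounded [M [Mreal HM]]|[M HM]].
  exists (M + 1) => x Mx; apply/eqP/negPn/negP => fx0.
  have sx : closure [set x | f x != 0] x by apply: subset_closure.
  have /= := HM (M + 1) _ x sx.
  by rewrite ltrDl ltr01 => /(_ isT); rewrite leNgt Mx.
apply: (@subclosed_compact _ _ `[- M, M]); first exact: closed_closure.
  exact: segment_compact.
rewrite [X in _ `<=` X](closure_id _).1; last exact: itv_closed.
apply: closure_subset => x /= fx0; rewrite in_itv/= -ler_norml leNgt.
by apply/negP => /HM fx; rewrite fx eqxx in fx0.
Qed.

Lemma derive1n_support f (M : R) n : (forall x, M < `|x| -> f x = 0) ->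
  forall x, M < `|x| -> f^`(n) x = 0.
Proof.
move=> f0; elim: n => // n IH x Mx; rewrite derive1nS derive1E.
rewrite (@near_eq_derive _ _ _ _ (fun=> 0))//; first by rewrite derive_cst.
have : \forall y \near x, M < `|y| :> R.
  apply/nbhs_normP; exists (`|x| - M) => /=; first by rewrite subr_gt0.
  move=> y /= xy; have := ler_distD y x 0; rewrite !subr0; lra.
by apply: filterS => y /IH.
Qed.

End complex_valued.

Section test_spaces.
Variable R : realType.

Lemma smooth_norm_continuous (f : R -> Rcomplex R) n : smooth f ->
  continuous (fun x => `|f^`(n) x|).
Proof.
move=> sf x; apply: (@continuous_comp _ (Rcomplex R) _ f^`(n) Num.norm).
  by apply: differentiable_continuous; apply/derivable1_diffP; exact: sf.
exact: norm_continuous.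
Qed.

Lemma smooth_norm_measurable (f : R -> Rcomplex R) n
    (D : set R) : smooth f ->
  measurable_fun D (fun x => `|derive1n n f x|).
Proof.
move=> sf; apply: measurable_funTS.
by apply: continuous_measurable_fun; exact: smooth_norm_continuous.
Qed.

Definition is_testfun : {pred R -> R[i]} :=
  mem [set f | smooth f /\ compact (closure [set x | f x != 0])].

Record testfun := Testfun {
  testfun_val :> R -> R[i];
  testfunP : testfun_val \in is_testfun }.

HB.instance Definition _ := [isSub for testfun_val].
HB.instance Definition _ := [Choice of testfun by <:].

Lemma is_testfun_submod_closed : submod_closed is_testfun.
Proof.
split=> [|a f g].
  rewrite inE/=; split; first exact: smooth0.
  by apply/compact_supportP; exists 0.
rewrite !inE/= => -[sf /compact_supportP[M fM]] [sg /compact_supportP[N gN]].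
split; first exact: smooth_lin.
apply/compact_supportP; exists (Num.max M N) => x.
by rewrite gt_max => /andP[/fM/= fx /gN/= gx]; rewrite /= !fctE fx gx scaler0 addr0.
Qed.

HB.instance Definition _ := GRing.isSubmodClosed.Build _ _ is_testfun
  is_testfun_submod_closed.
HB.instance Definition _ := [SubChoice_isSubLmodule of testfun by <:].

Definition is_smoothL1 : {pred R -> R[i]} :=
  mem [set f | smooth f /\ forall n,
    lebesgue_measure.-integrable setT
      (fun x => (`|derive1n n (f : R -> Rcomplex R) x|)%:E)].

Record smoothL1 := SmoothL1 {
  smoothL1_val :> R -> R[i];
  smoothL1P : smoothL1_val \in is_smoothL1 }.

HB.instance Definition _ := [isSub for smoothL1_val].
HB.instance Definition _ := [Choice of smoothL1 by <:].

Lemma is_testfun_smoothL1 : {subset is_testfun <= is_smoothL1}.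
Proof.
move=> f; rewrite !inE/= => -[sf /compact_supportP[M fM]]; split=> // n.
rewrite [X in _.-integrable _ X](_ : _ =
    (fun x => (`|derive1n n (f : R -> Rcomplex R) x|)%:E) \_ `[- M, M]).
  apply: (integrable_mkcond _ _).1; first exact: measurable_itv.
  apply: (@continuous_compact_integrable R
    (fun x => `|derive1n n (f : R -> Rcomplex R) x|) `[- M, M]).
    exact: segment_compact.
  by apply: continuous_subspaceT; exact: smooth_norm_continuous.
rewrite funeqE => x; rewrite patchE; case: ifPn => // /negP xM.
rewrite (derive1n_support n fM) ?normr0// ltNge.
by apply/negP; rewrite ler_norml => xM'; apply: xM; rewrite inE/= in_itv.
Qed.

Lemma is_smoothL1_submod_closed : submod_closed is_smoothL1.
Proof.
split=> [|a f g].
  by apply: is_testfun_smoothL1; case: is_testfun_submod_closed.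
rewrite !inE/= => -[sf fi] [sg gi]; split; first exact: smooth_lin.
move=> n; rewrite (derive1n_smooth_lin a sf sg n).
have := integrableD measurableT
  (integrableZl measurableT `|a : Rcomplex R| (fi n)) (gi n).
apply: le_integrable => //.
  have := @smooth_norm_measurable _ n setT (smooth_lin (a:=a) sf sg).
  by rewrite (derive1n_smooth_lin a sf sg n) => /measurable_EFinP.
move=> x _ /=; rewrite lee_fin normr_id.
by rewrite (le_trans (ler_normD _ _))// Rcomplex_normrM ger0_norm.
Qed.

HB.instance Definition _ := GRing.isSubmodClosed.Build _ _ is_smoothL1
  is_smoothL1_submod_closed.
HB.instance Definition _ := [SubChoice_isSubLmodule of smoothL1 by <:].

Definition testfun_smoothL1 (phi : testfun) : smoothL1 :=
  SmoothL1 (is_testfun_smoothL1 (testfunP phi)).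

Lemma testfun_derive_subproof (phi : testfun) :
  derive1 (phi : R -> Rcomplex R) \in is_testfun.
Proof.
have := testfunP phi; rewrite !inE/= => -[sf /compact_supportP[M fM]].
split; first exact: smooth_derive.
by apply/compact_supportP; exists M; exact: (derive1n_support 1 fM).
Qed.

Definition testfun_derive (phi : testfun) : testfun :=
  Testfun (testfun_derive_subproof phi).

Lemma testfun_reflect_subproof (x : R) (phi : testfun) :
  (fun y => phi (x - y)) \in is_testfun.
Proof.
have := testfunP phi; rewrite !inE/= => -[sf /compact_supportP[M fM]].
split; first exact: (@smooth_reflect R phi x sf).
apply/compact_supportP; exists (M + `|x|) => y My; apply: fM.
by have := ler_distD x y 0; rewrite !subr0 distrC; lra.
Qed.

Definition testfun_reflect (x : R) (phi : testfun) : testfun :=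
  Testfun (testfun_reflect_subproof x phi).

End test_spaces.

Section distributions.
Variable R : realType.

Definition sup_norm m (f : R -> Rcomplex R) : R :=
  \sum_(i < m.+1) sup (range (fun x => `|derive1n i f x|)).

Definition L1_norm m (f : R -> Rcomplex R) : R :=
  \sum_(i < m.+1) \int[lebesgue_measure]_x `|derive1n i f x|.

(* Continuity on A for the topology defined by the norms q 0, q 1, ...; both
   families of norms above are nondecreasing in m, so that the balls of the
   single norms q m form a neighborhood base. *)
Definition norms_continuous (V : lmodType R[i]) (q : nat -> V -> R) (A : set V)
    (T : V -> R[i]) : Prop :=
  forall u, A u -> forall e : R, 0 < e ->
    exists m, exists2 d : R, 0 < d &
      forall v, A v -> q m (v - u) < d -> `|(T v - T u : Rcomplex R)| < e.

(* The topology of the space D of test functions is the inductive limit of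
   those of the subspaces D_K of functions supported in a compact set K: a
   linear functional is continuous on D iff it is so on every D_K. *)
Record distrib := Distrib {
  distrib_val :> {scalar (testfun R)};
  distrib_continuous : forall K : set R, compact K ->
    norms_continuous (fun m (phi : testfun R) => sup_norm m phi)
      [set phi : testfun R | closure [set x | phi x != 0] `<=` K] distrib_val }.

Definition distrib_derive (T : testfun R -> R[i]) (phi : testfun R) :
    R[i] :=
  - T (testfun_derive phi).

Definition distrib_conv (T : testfun R -> R[i]) (phi : testfun R) (x : R) :
    R[i] :=
  T (testfun_reflect x phi).

(* T is (the restriction to D of) a continuous linear functional on D_{L^1}. *)
Definition bounded_distrib (T : distrib) : Prop :=
  exists2 T1 : {scalar (smoothL1 R)},
    norms_continuous (fun m (psi : smoothL1 R) => L1_norm m psi) setT T1 &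
    forall phi : testfun R, T phi = T1 (testfun_smoothL1 phi).

Definition almost_automorphic (f : R -> Rcomplex R) : Prop :=
  continuous f /\
  forall s : nat -> R,
    exists2 k : nat -> nat, {homo k : m n / (m < n)%N} &
    exists2 g : R -> Rcomplex R,
      forall x, f (x + s (k n)) @[n --> \oo] --> g x &
      forall x, g (x - s (k n)) @[n --> \oo] --> f x.

(* Equivalently, T is a finite sum of derivatives of almost automorphic
   functions; the definition by regularization is the one used here. *)
Definition almost_automorphic_distrib (T : distrib) : Prop :=
  bounded_distrib T /\
  forall phi : testfun R, almost_automorphic (distrib_conv T phi).

Definition solves_linear_system p (A : 'M[R[i]]_p)
    (S U : 'I_p -> distrib) : Prop :=
  forall (i : 'I_p) (phi : testfun R),
    distrib_derive (U i) phi = \sum_j A i j * U j phi + S i phi.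

End distributions.

(* Main.v *)
(* Putzer's scheme reduces the system to scalar equations.  Let l_1, ..., l_p be
   the roots of the characteristic polynomial, so that the product of the
   A - l_k vanishes.  If r solves r' = l_1 r + S, the ansatz U = r + U' turns
   U' = A U + S into the same system with right-hand side (A - l_1) r, which is
   annihilated by the product of the remaining factors.  Uniqueness goes down
   the same list of factors.
   For a scalar u' = l u + S put c = sgn (Re l), a = c l, so that Re a > 0, and
   let K f (x) be the integral over s >= 0 of e^(- a s) f(x - c s).  Integrating
   by parts, a K f + c K f' = f, and K is bounded on D_{L^1}: so
   <u, phi> = - c <S, K phi> is a bounded solution.  Conversely, for a bounded
   solution u the regularization v = u * phi is a bounded function with
   v' = l v + S * phi, and the same identity for the reflected kernel K' gives
   v = - c K' (S * phi).  This yields uniqueness, and by dominated convergence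
   v is almost automorphic when S * phi is. *)
Require Import Defs.
From HB Require Import structures.
From mathcomp Require Import all_boot all_order all_algebra.
From mathcomp Require Import all_classical all_reals all_analysis.
From mathcomp Require Import measurable_realfun ring lra.

Set Implicit Arguments.
Unset Strict Implicit.
Unset Printing Implicit Defensive.

Import Order.TTheory GRing.Theory Num.Theory numFieldNormedType.Exports.

Local Open Scope ring_scope.
Local Open Scope classical_set_scope.

(** * Functions with values in Rcomplex R *)
Section Rcomplex_components.
Variable R : realType.
Local Notation C := (Rcomplex R).

Lemma Rcomplex_normE (z : C) :
  `|z| = Num.sqrt (complex.Re z ^+ 2 + complex.Im z ^+ 2).
Proof. by case: z. Qed.

Lemma normc_Re (z : C) : `|complex.Re z| <= `|z|.
Proof. by rewrite Rcomplex_normE -sqrtr_sqr ler_wsqrtr// lerDl sqr_ge0. Qed.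

Lemma normc_Im (z : C) : `|complex.Im z| <= `|z|.
Proof. by rewrite Rcomplex_normE -sqrtr_sqr ler_wsqrtr// lerDr sqr_ge0. Qed.

Lemma normc_ReIm (z : C) : `|z| <= `|complex.Re z| + `|complex.Im z|.
Proof.
rewrite Rcomplex_normE -[leRHS]ger0_norm ?addr_ge0// -sqrtr_sqr ler_wsqrtr//.
rewrite sqrrD !real_normK ?num_real// addrAC.
by rewrite lerDl mulrn_wge0// mulr_ge0.
Qed.

Lemma RcomplexE (z : C) : z = Complex (complex.Re z) (complex.Im z).
Proof. by case: z. Qed.

Lemma ReMc (z w : C) : complex.Re (z * w : C) =
  complex.Re z * complex.Re w - complex.Im z * complex.Im w.
Proof. by case: z; case: w. Qed.

Lemma ImMc (z w : C) : complex.Im (z * w : C) =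
  complex.Re z * complex.Im w + complex.Im z * complex.Re w.
Proof. by case: z; case: w. Qed.

Lemma ReDc (z w : C) : complex.Re (z + w : C) = complex.Re z + complex.Re w.
Proof. by case: z; case: w. Qed.

Lemma ImDc (z w : C) : complex.Im (z + w : C) = complex.Im z + complex.Im w.
Proof. by case: z; case: w. Qed.

Lemma ReBc (z w : C) : complex.Re (z - w : C) = complex.Re z - complex.Re w.
Proof. by case: z; case: w. Qed.

Lemma ImBc (z w : C) : complex.Im (z - w : C) = complex.Im z - complex.Im w.
Proof. by case: z; case: w. Qed.

Lemma ReZc (k : R) (z : C) : complex.Re (k *: z : C) = k * complex.Re z.
Proof. by case: z. Qed.

Lemma ImZc (k : R) (z : C) : complex.Im (k *: z : C) = k * complex.Im z.
Proof. by case: z. Qed.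

Lemma cvg_Rcomplex (T : Type) (F : set_system T) {FF : Filter F} (f : T -> C)
    (l : C) :
  f @ F --> l <->
  (complex.Re (f x) @[x --> F] --> complex.Re l) /\
  (complex.Im (f x) @[x --> F] --> complex.Im l).
Proof.
split=> [/cvgrPdist_le fl|[/cvgrPdist_le rl /cvgrPdist_le il]].
  split; apply/cvgrPdist_le => e e0; have := fl _ e0; apply: filterS => x.
    by apply: le_trans; rewrite -ReBc normc_Re.
  by apply: le_trans; rewrite -ImBc normc_Im.
apply/(@cvgrPdist_le _ C) => e e0.
have e2 : 0 < e / 2 by rewrite divr_gt0.
have := rl _ e2; have := il _ e2; apply: filterS2 => x ix rx.
by rewrite (le_trans (normc_ReIm _))// ReBc ImBc (splitr e) lerD.
Qed.

Lemma Re_cvg (T : Type) (F : set_system T) {FF : Filter F} (f : T -> C)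
    (l : C) : f @ F --> l -> complex.Re (f x) @[x --> F] --> complex.Re l.
Proof. by move=> /cvg_Rcomplex[]. Qed.

Lemma Im_cvg (T : Type) (F : set_system T) {FF : Filter F} (f : T -> C)
    (l : C) : f @ F --> l -> complex.Im (f x) @[x --> F] --> complex.Im l.
Proof. by move=> /cvg_Rcomplex[]. Qed.

Lemma continuous_Rcomplex (T : topologicalType) (f : T -> C) : continuous f <->
  continuous (fun x => complex.Re (f x)) /\ continuous (fun x => complex.Im (f x)).
Proof.
split=> [cf|[cr ci] x]; last by apply/cvg_Rcomplex; split; [exact: cr|exact: ci].
by split=> x; [exact: Re_cvg (cf x)|exact: Im_cvg (cf x)].
Qed.

Lemma continuous_Mc (T : topologicalType) (f g : T -> C) :
  continuous f -> continuous g -> continuous (fun x => f x * g x : C).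
Proof.
move=> /continuous_Rcomplex[fr fi] /continuous_Rcomplex[gr gi].
apply/continuous_Rcomplex; split=> x.
  under eq_fun do rewrite ReMc.
  by apply: cvgB; apply: cvgM; [exact: fr|exact: gr|exact: fi|exact: gi].
under eq_fun do rewrite ImMc.
by apply: cvgD; apply: cvgM; [exact: fr|exact: gi|exact: fi|exact: gr].
Qed.

Lemma is_derive_cvgR (f : R -> R) (x l : R) :
  h^-1 *: (f (h + x) - f x) @[h --> 0^'] --> l <-> is_derive x 1 f l.
Proof.
have E : (fun h : R => h^-1 *: ((f \o shift x) (h *: (1 : R)) - f x)) =
         (fun h => h^-1 *: (f (h + x) - f x)).
  by rewrite funeqE => h; rewrite /= /GRing.scale/= mulr1.
split=> [H|[H H']].
  split; first by rewrite /derivable E; apply/cvg_ex; exists l.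
  by rewrite /derive E; apply/cvg_lim.
by rewrite -H' -E /derive; exact: H.
Qed.

Lemma is_derive_Rcomplex (f : R -> C) (x : R) (l : C) : is_derive x 1 f l <->
  is_derive x 1 (fun y => complex.Re (f y)) (complex.Re l) /\
  is_derive x 1 (fun y => complex.Im (f y)) (complex.Im l).
Proof.
split=> [/is_derive_cvg/cvg_Rcomplex[Hr Hi]|[/is_derive_cvgR Hr /is_derive_cvgR Hi]].
  split; apply/is_derive_cvgR.
    by under eq_fun do rewrite -ReBc -[_ *: _]ReZc.
  by under eq_fun do rewrite -ImBc -[_ *: _]ImZc.
apply/is_derive_cvg/cvg_Rcomplex; split.
  by under eq_fun do rewrite ReZc ReBc.
by under eq_fun do rewrite ImZc ImBc.
Qed.

Lemma is_derive_Mc (f g : R -> C) (x : R) (df dg : C) :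
  is_derive x 1 f df -> is_derive x 1 g dg ->
  is_derive x 1 (fun y => f y * g y : C) (df * g x + f x * dg : C).
Proof.
move=> /is_derive_Rcomplex[fr fi] /is_derive_Rcomplex[gr gi].
apply/is_derive_Rcomplex; split.
  under eq_fun do rewrite ReMc.
  by apply: is_derive_eq; rewrite !(ReDc, ReMc) /GRing.scale/=; ring.
under eq_fun do rewrite ImMc.
by apply: is_derive_eq; rewrite !(ImDc, ImMc) /GRing.scale/=; ring.
Qed.

Lemma is_derive_continuous (V : normedModType R) (f df : R -> V) :
  (forall x : R, is_derive x 1 f (df x)) -> continuous f.
Proof.
move=> fdf x; apply: differentiable_continuous; apply/derivable1_diffP.
by have [] := fdf x.
Qed.

(** A quadratic remainder estimate passes through bounded linear maps. With this criterion,
    convolutions with distributions and [green f] are differentiated by applying the map to a Taylor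
    remainder, with no exchange of limits. *)
Lemma is_derive_quadratic (f : R -> C) (x B : R) (l : C) :
  (forall h, `|h| <= 1 -> `|f (x + h) - f x - h *: l| <= B * h ^+ 2) ->
  is_derive x 1 f l.
Proof.
move=> H; apply/is_derive_cvg; apply/(@cvgrPdist_le _ C) => e e0.
(* [B] may be 0, and the radius below needs a positive divisor. *)
have B1 : 0 < `|B| + 1 by rewrite ltr_wpDl.
near=> h.
have h0 : h != 0 by near: h; exact: nbhs_dnbhs_neq.
have h1 : `|h| <= 1.
  near: h; apply: dnbhs0_le; exact: ltr01.
have he : `|h| <= e / (`|B| + 1).
  by near: h; apply: dnbhs0_le; rewrite divr_gt0.
have -> : l - h^-1 *: (f (h + x) - f x) =
    - h^-1 *: (f (x + h) - f x - h *: l).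
  by rewrite scaleNr -scalerN opprB [RHS]scalerBr scalerA mulVf// scale1r (addrC h).
rewrite normrZ normrN normfV mulrC ler_pdivrMr ?normr_gt0//.
apply: (le_trans (H _ h1)); rewrite -[h ^+ 2]real_normK ?num_real// expr2 mulrA.
rewrite ler_pM2r ?normr_gt0//; rewrite ler_pdivlMr// in he.
apply: le_trans he; rewrite mulrC ler_wpM2l//.
by rewrite (le_trans (ler_norm _))// lerDl.
Unshelve. all: by end_near. Qed.

Lemma lipschitz_is_deriveR (f df : R -> R) (B : R) :
  (forall x : R, is_derive x 1 f (df x)) -> (forall x, `|df x| <= B) ->
  forall x y, `|f y - f x| <= B * `|y - x|.
Proof.
move=> fdf dfB x y; wlog xy : x y / x <= y.
  move=> W; have [/W//|/ltW/W] := leP x y.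
  by rewrite distrC [`|x - y|]distrC.
have [c _ ->] := @MVT_segment _ f df x y xy (fun z _ => fdf z)
  (continuous_subspaceT (is_derive_continuous fdf)).
by rewrite normrM ler_wpM2r.
Qed.

(** The mean value theorem turns the increment of [f] into [df c * h] with [c] at distance at most
    |h| from [x], and [df] is Lipschitz with constant [B]. The factor 1/2 of Taylor's formula is
    given up. *)
Lemma taylor_is_deriveR (f df ddf : R -> R) (B : R) :
  (forall x : R, is_derive x 1 f (df x)) ->
  (forall x : R, is_derive x 1 df (ddf x)) ->
  (forall x, `|ddf x| <= B) ->
  forall x h, `|f (x + h) - f x - h * df x| <= B * h ^+ 2.
Proof.
move=> fdf dfd dB x h.
have B0 : 0 <= B by apply: le_trans (dB 0).
have cf := continuous_subspaceT (is_derive_continuous fdf).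
have [c [fc cx]] : exists c, f (x + h) - f x = df c * h /\ `|c - x| <= `|h|.
  have [h0|h0] := leP 0 h.
    have xh : x <= x + h by rewrite lerDl.
    have [c cx ->] := @MVT_segment _ f df x (x + h) xh (fun z _ => fdf z) (cf _).
    exists c; split; first by rewrite addrAC subrr add0r.
    move: cx; rewrite in_itv/= => /andP[? ?].
    by rewrite !ger0_norm; lra.
  have xh : x + h <= x by rewrite gerDl ltW.
  have [c cx E] := @MVT_segment _ f df (x + h) x xh (fun z _ => fdf z) (cf _).
  exists c; split; first by rewrite -[LHS]opprB E; ring.
  move: cx; rewrite in_itv/= => /andP[? ?].
  by rewrite ler0_norm ?(ltr0_norm h0); lra.
have -> : f (x + h) - f x - h * df x = (df c - df x) * h by rewrite fc; ring.
rewrite normrM -[h ^+ 2]real_normK ?num_real// expr2 mulrA ler_wpM2r//.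
by apply: (le_trans (lipschitz_is_deriveR dfd dB _ _)); rewrite ler_wpM2l.
Qed.

(** The mean value theorem is a real statement, so the estimate is made on each component; adding
    the two bounds costs the factor 2. *)
Lemma taylor_is_derive (f df ddf : R -> C) (B : R) :
  (forall x : R, is_derive x 1 f (df x)) ->
  (forall x : R, is_derive x 1 df (ddf x)) ->
  (forall x, `|ddf x| <= B) ->
  forall x h, `|f (x + h) - f x - h *: df x| <= (2 * B) * h ^+ 2.
Proof.
move=> fdf dfd dB x h; apply: (le_trans (normc_ReIm _)).
rewrite -mulrA mulr2n mulrDl !mul1r; apply: lerD.
  rewrite !ReBc ReZc; apply: (@taylor_is_deriveR (fun x => complex.Re (f x))
    (fun x => complex.Re (df x)) (fun x => complex.Re (ddf x))) => y.
  - by have /is_derive_Rcomplex[] := fdf y.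
  - by have /is_derive_Rcomplex[] := dfd y.
  - by rewrite (le_trans (normc_Re _)).
rewrite !ImBc ImZc; apply: (@taylor_is_deriveR (fun x => complex.Im (f x))
  (fun x => complex.Im (df x)) (fun x => complex.Im (ddf x))) => y.
- by have /is_derive_Rcomplex[] := fdf y.
- by have /is_derive_Rcomplex[] := dfd y.
- by rewrite (le_trans (normc_Im _)).
Qed.

End Rcomplex_components.

(** * Integrals over the half-line with an exponential weight *)
Section exponential_weight.
Variable R : realType.
Local Notation C := (Rcomplex R).
Local Notation mu := (@lebesgue_measure R).
Local Notation Rp := (`[0%R, +oo[ : set R).

Lemma is_derive_expN (m s : R) :
  is_derive s 1 (fun s => expR (- m * s)) (- m * expR (- m * s)).
Proof.
by apply: is_derive_eq; rewrite /GRing.scale/= mulr1 mulrC.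
Qed.

Lemma cvgy_expN (m : R) : 0 < m -> expR (- m * s) @[s --> +oo] --> 0.
Proof.
move=> m0; rewrite (_ : (fun s => _) =
  (fun z => expR (- z)) \o (fun z => m * z)); last first.
  by apply: eq_fun => x /=; rewrite mulNr.
apply: (@cvg_comp _ _ _ _ _ _ (pinfty_nbhs R)); last exact: cvgr_expR.
exact: gt0_cvgMry.
Qed.

Lemma continuous_expN (m : R) : continuous (fun s => expR (- m * s)).
Proof. exact: is_derive_continuous (is_derive_expN m). Qed.

Lemma ge0_integral_derivey (F f : R -> R) (l : R) :
  (forall s : R, is_derive s 1 F (f s)) -> continuous f ->
  (forall s : R, 0 <= s -> 0 <= f s) -> F s @[s --> +oo] --> l ->
  (\int[mu]_(s in Rp) (f s)%:E = (l - F 0)%:E)%E.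
Proof.
move=> Ff cf f0 Fl; rewrite (@ge0_continuous_FTC2y _ f F 0 l)//.
- exact: continuous_subspaceT.
- exact/cvg_at_right_filter/(is_derive_continuous Ff).
- by move=> s _; rewrite derive1E; have [_ ->] := Ff s.
Qed.

Lemma integral_expN (m : R) : 0 < m ->
  (\int[mu]_(s in Rp) (expR (- m * s))%:E = (m^-1)%:E)%E.
Proof.
move=> m0.
have D (s : R) : is_derive s 1 (fun s => - m^-1 * expR (- m * s)) (expR (- m * s)).
  apply: (is_derive_eq (is_deriveZ (- m^-1) (is_derive_expN m s))).
  by rewrite /GRing.scale/= mulrA mulrNN mulVf ?gt_eqF// mul1r.
rewrite (@ge0_integral_derivey _ _ 0 D); first by rewrite mulr0 expR0 mulr1 sub0r opprK.
- exact: continuous_expN.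
- by move=> s _; exact: expR_ge0.
- by rewrite -(mulr0 (- m^-1)); apply: cvgMr; exact: cvgy_expN.
Qed.

Lemma continuous_measurable_on (D : set R) (f : R -> R) :
  continuous f -> measurable_fun D f.
Proof. by move=> cf; apply: measurable_funTS; exact: continuous_measurable_fun. Qed.

Lemma integrable_expN (m : R) : 0 < m ->
  mu.-integrable Rp (EFin \o (fun s => expR (- m * s))).
Proof.
move=> m0; apply/integrableP; split.
  apply/measurable_EFinP; apply: continuous_measurable_on.
  exact: continuous_expN.
under eq_integral do rewrite gee0_abs ?lee_fin ?expR_ge0//.
by rewrite integral_expN// ltry.
Qed.

Lemma integrable_ZexpN (m B : R) : 0 < m ->
  mu.-integrable Rp (EFin \o (fun s => B * expR (- m * s))).
Proof.
move=> m0; rewrite (_ : EFin \o _ =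
  (fun s => B%:E * (expR (- m * s))%:E)%E); last by apply/funext.
by apply: integrableZl => //; exact: integrable_expN.
Qed.

Lemma Rintegral_ZexpN (m B : R) : 0 < m ->
  \int[mu]_(s in Rp) (B * expR (- m * s)) = B / m.
Proof.
move=> m0; rewrite RintegralZl//; last exact: integrable_expN.
by rewrite /Rintegral integral_expN.
Qed.

Lemma integral_derivey (F f : R -> R) (m B B' : R) : 0 < m ->
  (forall s : R, is_derive s 1 F (f s)) -> continuous f ->
  (forall s : R, 0 <= s -> `|f s| <= B * expR (- m * s)) ->
  (forall s : R, 0 <= s -> `|F s| <= B' * expR (- m * s)) ->
  \int[mu]_(s in Rp) f s = - F 0.
Proof.
move=> m0 Ff cf fB FB.
(* Adding B e^(- m s) makes the integrand nonnegative, so that the fundamental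
   theorem for nonnegative functions applies. *)
pose g s := f s + B * expR (- m * s).
pose G s := F s + - (B / m) * expR (- m * s).
have Gg (s : R) : is_derive s 1 G (g s).
  have h1 := is_deriveZ (- (B / m)) (is_derive_expN m s).
  apply: (is_derive_eq (is_deriveD (Ff s) h1)); rewrite /GRing.scale/=.
  by rewrite mulrA mulrNN divfK// gt_eqF.
have cE : continuous (fun s => B * expR (- m * s)).
  by move=> s; apply: cvgMr; exact: continuous_expN.
have cg : continuous g by move=> s; apply: cvgD; [exact: cf|exact: cE].
have F0 : F s @[s --> +oo] --> 0.
  apply/norm_cvg0P; apply: (@squeeze_cvgr _ _ _ _ (fun=> 0)
    (fun s => B' * expR (- m * s))).
  - near=> s.
    have s0 : 0 <= s by near: s; exact: nbhs_pinfty_ge.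
    by rewrite normr_ge0/= FB.
  - exact: cvg_cst.
  - by rewrite -(mulr0 B'); apply: cvgMr; exact: cvgy_expN.
have G0 : G s @[s --> +oo] --> 0.
  rewrite -(addr0 0) -[X in _ + X](mulr0 (- (B / m))).
  by apply: cvgD => //; apply: cvgMr; exact: cvgy_expN.
have mf : measurable_fun Rp f.
  exact: continuous_measurable_on.
have If : mu.-integrable Rp (EFin \o f).
  apply: (le_integrable _ _ _ (integrable_ZexpN B m0)) => //.
    exact/measurable_EFinP.
  move=> s; rewrite /= in_itv/= andbT lee_fin => s0.
  by rewrite (le_trans (fB _ s0))// ler_norm.
have : \int[mu]_(s in Rp) g s = B / m - F 0.
  rewrite /Rintegral (ge0_integral_derivey Gg cg _ G0)//=.
    by rewrite /G mulr0 expR0 mulr1; ring.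
  move=> s s0; have := fB _ s0; rewrite ler_norml /g => /andP[? _]; lra.
rewrite RintegralD//; last exact: integrable_ZexpN.
by rewrite Rintegral_ZexpN//; lra.
Unshelve. all: by end_near. Qed.

(** The exponential e^(- a s) for complex [a], given by its real and imaginary parts. *)
Definition cexpN (a : C) (s : R) : C :=
  Complex (expR (- complex.Re a * s) * cos (complex.Im a * s))
          (- (expR (- complex.Re a * s) * sin (complex.Im a * s))).

Lemma cexpN0 a : cexpN a 0 = 1.
Proof. by rewrite /cexpN !mulr0 expR0 cos0 sin0 mulr0 mulr1 oppr0. Qed.

Lemma norm_cexpN a s : `|cexpN a s| = expR (- complex.Re a * s).
Proof.
rewrite Rcomplex_normE /= sqrrN !exprMn -mulrDr cos2Dsin2 mulr1.
by rewrite sqrtr_sqr ger0_norm// expR_ge0.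
Qed.

Lemma is_derive_cexpN (a : C) (s : R) :
  is_derive s 1 (cexpN a) (- a * cexpN a s : C).
Proof.
apply/is_derive_Rcomplex; rewrite ReMc ImMc /=.
case: a => r i /=; split; apply: is_derive_eq;
  rewrite /GRing.scale/=; ring.
Qed.

Lemma continuous_cexpN a : continuous (cexpN a).
Proof. exact: is_derive_continuous (is_derive_cexpN a). Qed.

End exponential_weight.

(** * Exponentially dominated complex integrals over the half-line *)

Section halfline_integral.
Variable R : realType.
Local Notation C := (Rcomplex R).
Local Notation mu := (@lebesgue_measure R).
Local Notation Rp := (`[0%R, +oo[ : set R).

Definition halfline_int (h : R -> C) : C :=
  Complex (\int[mu]_(s in Rp) complex.Re (h s))
          (\int[mu]_(s in Rp) complex.Im (h s)).

(** Measurability is tracked rather than continuity because K will be applied to the limit functions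
    in the definition of almost automorphy, which need not be continuous. *)
Definition cmeasurable (h : R -> C) :=
  measurable_fun setT (fun x => complex.Re (h x)) /\
  measurable_fun setT (fun x => complex.Im (h x)).

Lemma continuous_cmeasurable h : continuous h -> cmeasurable h.
Proof.
by move=> /continuous_Rcomplex[hr hi]; split; exact: continuous_measurable_on.
Qed.

Lemma cmeasurableM h k : cmeasurable h -> cmeasurable k ->
  cmeasurable (fun x => h x * k x).
Proof.
move=> [hr hi] [kr ki]; split.
  under eq_fun do rewrite ReMc.
  by apply: measurable_funB; exact: measurable_funM.
under eq_fun do rewrite ImMc.
by apply: measurable_funD; exact: measurable_funM.
Qed.

Lemma cmeasurableD h k : cmeasurable h -> cmeasurable k ->
  cmeasurable (fun x => h x + k x).
Proof.
move=> [hr hi] [kr ki]; split.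
  by under eq_fun do rewrite ReDc; exact: measurable_funD.
by under eq_fun do rewrite ImDc; exact: measurable_funD.
Qed.

Lemma cmeasurableZ (z : C) h : cmeasurable h -> cmeasurable (fun x => z * h x).
Proof.
by apply: cmeasurableM; exact/continuous_cmeasurable/cst_continuous.
Qed.

Lemma cmeasurable_comp h (u : R -> R) : cmeasurable h -> continuous u ->
  cmeasurable (fun x => h (u x)).
Proof.
move=> [hr hi] cu.
have um : measurable_fun [set: R] u by exact: continuous_measurable_on.
by split; [exact: measurableT_comp hr um|exact: measurableT_comp hi um].
Qed.

Lemma cmeasurable_cvg (h_ : nat -> R -> C) (h : R -> C) :
  (forall n, cmeasurable (h_ n)) -> (forall x, h_ n x @[n --> \oo] --> h x) ->
  cmeasurable h.
Proof.
move=> mh hh; split.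
  apply: (@measurable_fun_cvg _ _ _ _ (fun n x => complex.Re (h_ n x))) => //.
    by move=> n; have [] := mh n.
  by move=> x _; exact: Re_cvg.
apply: (@measurable_fun_cvg _ _ _ _ (fun n x => complex.Im (h_ n x))) => //.
  by move=> n; have [] := mh n.
by move=> x _; exact: Im_cvg.
Qed.

Section dominated.
Variables (m : R) (m0 : 0 < m).

Definition expN_dominated (B : R) (h : R -> C) :=
  forall s, 0 <= s -> `|h s| <= B * expR (- m * s).

Lemma expN_dominatedZ (B : R) (z : C) (h : R -> C) : expN_dominated B h ->
  expN_dominated (`|z| * B) (fun s => z * h s).
Proof. by move=> hB s s0; rewrite Rcomplex_normrM -mulrA ler_wpM2l// hB. Qed.

Lemma expN_integrable (B : R) (h : R -> R) : measurable_fun setT h ->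
  (forall s, 0 <= s -> `|h s| <= B * expR (- m * s)) ->
  mu.-integrable Rp (EFin \o h).
Proof.
move=> mh hB; apply: (le_integrable _ _ _ (integrable_ZexpN B m0)) => //.
  by apply/measurable_EFinP; exact: measurable_funTS.
move=> s; rewrite /= in_itv/= andbT lee_fin => s0.
by rewrite (le_trans (hB _ s0))// ler_norm.
Qed.

Lemma Re_integrable (B : R) (h : R -> C) :
  cmeasurable h -> expN_dominated B h ->
  mu.-integrable Rp (EFin \o (fun s => complex.Re (h s))).
Proof.
move=> [mh _] hB; apply: expN_integrable mh _ => s s0.
exact: le_trans (normc_Re _) (hB _ s0).
Qed.

Lemma Im_integrable (B : R) (h : R -> C) :
  cmeasurable h -> expN_dominated B h ->
  mu.-integrable Rp (EFin \o (fun s => complex.Im (h s))).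
Proof.
move=> [_ mh] hB; apply: expN_integrable mh _ => s s0.
exact: le_trans (normc_Im _) (hB _ s0).
Qed.

Lemma halfline_intD (Bh Bk : R) (h k : R -> C) :
  cmeasurable h -> expN_dominated Bh h ->
  cmeasurable k -> expN_dominated Bk k ->
  halfline_int (fun s => h s + k s) = halfline_int h + halfline_int k :> C.
Proof.
move=> mh hB mk kB; rewrite [RHS]RcomplexE ReDc ImDc /=.
have := Re_integrable mh hB; have := Re_integrable mk kB.
have := Im_integrable mh hB; have := Im_integrable mk kB.
move=> ik ih rk rh; rewrite -!RintegralD//.
by congr Complex; apply: eq_Rintegral => s _; rewrite (ReDc, ImDc).
Qed.

Lemma halfline_intZ (B : R) (z : C) (h : R -> C) :
  cmeasurable h -> expN_dominated B h ->
  halfline_int (fun s => z * h s) = z * halfline_int h :> C.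
Proof.
move=> mh hB; rewrite [RHS]RcomplexE ReMc ImMc /=.
have rh := Re_integrable mh hB; have ih := Im_integrable mh hB.
have Z k : forall h : R -> R, mu.-integrable Rp (EFin \o h) ->
    mu.-integrable Rp (EFin \o (fun s => k * h s)).
  move=> g ig; rewrite (_ : EFin \o _ = (fun s => k%:E * (g s)%:E)%E);
    last by apply/funext.
  by apply: integrableZl.
rewrite -!RintegralZl// -RintegralB//; [|exact: Z|exact: Z].
rewrite -RintegralD//; [|exact: Z|exact: Z].
by congr Complex; apply: eq_Rintegral => s _; rewrite (ReMc, ImMc).
Qed.

(* The factor 2 comes from bounding the real and imaginary parts separately. *)
Lemma norm_halfline_int (h : R -> C) (g : R -> R) :
  cmeasurable h -> mu.-integrable Rp (EFin \o g) ->
  (forall s, 0 <= s -> `|h s| <= g s) ->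
  `|halfline_int h| <= 2 * \int[mu]_(s in Rp) g s.
Proof.
move=> [mr mi] ig hg; apply: (le_trans (normc_ReIm _)) => /=.
rewrite mulr2n mulrDl !mul1r.
suff H (k : R -> R) : measurable_fun setT k -> (forall s, `|k s| <= `|h s|) ->
    `|\int[mu]_(s in Rp) k s| <= \int[mu]_(s in Rp) g s.
  by apply: lerD; apply: H => // s; [exact: normc_Re|exact: normc_Im].
move=> mk kh.
have ik : mu.-integrable Rp (EFin \o k).
  apply: (le_integrable _ _ _ ig) => //.
    by apply/measurable_EFinP; exact: measurable_funTS.
  move=> s; rewrite /= in_itv/= andbT lee_fin => s0.
  by rewrite (le_trans (kh _))// (le_trans (hg _ s0))// ler_norm.
apply: (le_trans (le_normr_Rintegral _ ik)) => //.
apply: le_Rintegral => //.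
  rewrite (_ : EFin \o _ = abse \o (EFin \o k)); last by apply/funext.
  exact: integrable_abse.
move=> s; rewrite /= in_itv/= andbT => s0.
by rewrite (le_trans (kh _))// (le_trans (hg _ s0)).
Qed.

Lemma halfline_int_bound (B : R) (h : R -> C) :
  cmeasurable h -> expN_dominated B h -> `|halfline_int h| <= 2 * (B / m).
Proof.
move=> mh hB; rewrite -(Rintegral_ZexpN B m0).
by apply: norm_halfline_int => //; exact: integrable_ZexpN.
Qed.

Lemma Rintegral_dominated_cvg (B : R) (h_ : nat -> R -> R) (h : R -> R) :
  (forall n, measurable_fun setT (h_ n)) -> measurable_fun setT h ->
  (forall n s, 0 <= s -> `|h_ n s| <= B * expR (- m * s)) ->
  (forall s, h_ n s @[n --> \oo] --> h s) ->
  \int[mu]_(s in Rp) h_ n s @[n --> \oo] --> \int[mu]_(s in Rp) h s.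
Proof.
move=> mh_ mh hB hh.
have [|||||ih _ H] := @dominated_convergence _ _ R mu Rp _
  (fun n s => (h_ n s)%:E) (fun s => (h s)%:E)
  (EFin \o (fun s => B * expR (- m * s))) _ _ _ (integrable_ZexpN B m0) => //.
- move=> n; apply/measurable_EFinP. apply: measurable_funTS; exact: mh_.
- by apply/measurable_EFinP; exact: measurable_funTS.
- by apply: aeW => s _; apply: cvg_EFin; [exact: nearW|exact: hh].
- apply: aeW => s n; rewrite /= in_itv/= andbT lee_fin; exact: hB.
by apply: fine_cvg; rewrite fineK//; exact: integrable_fin_num.
Qed.

Lemma halfline_int_cvg (B : R) (h_ : nat -> R -> C) (h : R -> C) :
  (forall n, cmeasurable (h_ n)) -> (forall n, expN_dominated B (h_ n)) ->
  (forall s, h_ n s @[n --> \oo] --> h s) ->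
  halfline_int (h_ n) @[n --> \oo] --> halfline_int h.
Proof.
move=> mh hB hh; have [mr mi] := cmeasurable_cvg mh hh.
apply/cvg_Rcomplex; split; apply: (@Rintegral_dominated_cvg B) => //.
- by move=> n; have [] := mh n.
- by move=> n s s0; exact: le_trans (normc_Re _) (hB n s s0).
- by move=> s; exact: Re_cvg.
- by move=> n; have [] := mh n.
- by move=> n s s0; exact: le_trans (normc_Im _) (hB n s s0).
- by move=> s; exact: Im_cvg.
Qed.

(** The domination of [h] makes the integral converge, and that of [H] makes the boundary term at
    infinity vanish. *)
Lemma halfline_int_derive (B B' : R) (H h : R -> C) :
  (forall s : R, is_derive s 1 H (h s)) -> continuous h ->
  expN_dominated B h -> expN_dominated B' H ->
  halfline_int h = - H 0.
Proof.
move=> Hh /continuous_Rcomplex[cr ci] hB HB'; rewrite [RHS]RcomplexE.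
congr Complex.
  have -> : complex.Re (- H 0) = - complex.Re (H 0) by case: (H 0).
  apply: (@integral_derivey _ (fun s => complex.Re (H s)) _ m B B') => //.
  - by move=> s; have /is_derive_Rcomplex[] := Hh s.
  - by move=> s s0; exact: le_trans (normc_Re _) (hB s s0).
  - by move=> s s0; exact: le_trans (normc_Re _) (HB' s s0).
have -> : complex.Im (- H 0) = - complex.Im (H 0) by case: (H 0).
apply: (@integral_derivey _ (fun s => complex.Im (H s)) _ m B B') => //.
- by move=> s; have /is_derive_Rcomplex[] := Hh s.
- by move=> s s0; exact: le_trans (normc_Im _) (hB s s0).
- by move=> s s0; exact: le_trans (normc_Im _) (HB' s s0).
Qed.

End dominated.
End halfline_integral.

(** * The Green operator *)
Section green_operator.
Variable R : realType.
Local Notation C := (Rcomplex R).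
Local Notation mu := (@lebesgue_measure R).
Local Notation Rp := (`[0%R, +oo[ : set R).
Variables (a : C) (c : R).

(* The operator K above. *)
Definition green (f : R -> C) (x : R) : C :=
  halfline_int (fun s => cexpN a s * f (x - c * s)).

(** Commutation with translations brings the increments in Taylor remainders, and the shifts in
    almost automorphy, inside the operator. *)
Lemma green_shift (f : R -> C) (x y : R) :
  green (fun z => f (z + y)) x = green f (x + y).
Proof.
by rewrite /green; congr halfline_int; apply/funext => s; rewrite addrAC.
Qed.

Hypothesis a0 : 0 < complex.Re a.

Lemma green_kernel_cmeasurable (f : R -> C) (x : R) : cmeasurable f ->
  cmeasurable (fun s => cexpN a s * f (x - c * s)).
Proof.
move=> mf; apply: cmeasurableM.
  exact/continuous_cmeasurable/continuous_cexpN.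
apply: cmeasurable_comp => // s; apply: cvgB; first exact: cvg_cst.
exact: cvgMr.
Qed.

Lemma green_kernel_dominated (B : R) (f : R -> C) (x : R) :
  (forall y, `|f y| <= B) ->
  expN_dominated (complex.Re a) B (fun s => cexpN a s * f (x - c * s)).
Proof.
move=> fB s s0; rewrite Rcomplex_normrM norm_cexpN mulrC.
by rewrite ler_wpM2r// expR_ge0.
Qed.

Lemma greenD (Bf Bg : R) (f g : R -> C) (x : R) :
  cmeasurable f -> (forall y, `|f y| <= Bf) ->
  cmeasurable g -> (forall y, `|g y| <= Bg) ->
  green (fun y => f y + g y) x = green f x + green g x :> C.
Proof.
move=> mf fB mg gB; rewrite /green -(halfline_intD a0 _
  (green_kernel_dominated x fB) _ (green_kernel_dominated x gB)) //;
  try exact: green_kernel_cmeasurable.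
by congr halfline_int; apply/funext => s; rewrite mulrDr.
Qed.

Lemma greenZ (B : R) (z : C) (f : R -> C) (x : R) :
  cmeasurable f -> (forall y, `|f y| <= B) ->
  green (fun y => z * f y) x = z * green f x :> C.
Proof.
move=> mf fB; rewrite /green -(halfline_intZ a0 _ _ (green_kernel_dominated x fB)) //;
  try exact: green_kernel_cmeasurable.
by congr halfline_int; apply/funext => s; rewrite mulrCA.
Qed.

Lemma green_bound (B : R) (f : R -> C) (x : R) :
  cmeasurable f -> (forall y, `|f y| <= B) ->
  `|green f x| <= 2 * (B / complex.Re a).
Proof.
move=> mf fB; apply: (halfline_int_bound a0).
  exact: green_kernel_cmeasurable.
exact: green_kernel_dominated.
Qed.

Lemma green_cvg (B : R) (f_ : nat -> R -> C) (f : R -> C) (x : R) :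
  (forall n, cmeasurable (f_ n)) -> (forall n y, `|f_ n y| <= B) ->
  (forall y, f_ n y @[n --> \oo] --> f y) ->
  green (f_ n) x @[n --> \oo] --> green f x.
Proof.
move=> mf fB ff; apply: (@halfline_int_cvg _ _ a0 B
  (fun n s => cexpN a s * f_ n (x - c * s))).
- by move=> n; exact: green_kernel_cmeasurable.
- by move=> n; exact: green_kernel_dominated.
- by move=> s; apply: (cvg_comp _ _ (ff _)); exact: continuous_mulc.
Qed.

Lemma is_derive_comp_line (f : R -> C) (x s : R) (l : C) :
  is_derive (x - c * s) 1 f l ->
  is_derive s 1 (fun t => f (x - c * t)) (- c *: l : C).
Proof.
move=> /is_derive_Rcomplex[fr fi]; apply/is_derive_Rcomplex.
have D : is_derive s 1 (fun t : R => x - c * t) (- c).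
  by apply: is_derive_eq; rewrite /GRing.scale/=; ring.
rewrite ReZc ImZc; split.
  by have := @is_derive1_comp _ _ (fun t : R => x - c * t) _ _ _ fr D; rewrite mulrC.
by have := @is_derive1_comp _ _ (fun t : R => x - c * t) _ _ _ fi D; rewrite mulrC.
Qed.

Lemma scaleRcE (k : R) (z : C) : k *: z = k%:C%C * z :> C.
Proof.
by rewrite [LHS]RcomplexE [RHS]RcomplexE ReZc ImZc ReMc ImMc /= !mul0r subr0 addr0.
Qed.

Lemma continuous_line (x : R) : continuous (fun s : R => x - c * s).
Proof. by move=> s; apply: cvgB; [exact: cvg_cst|exact: cvgMr]. Qed.

(** The derivative in [s] of e^(- a s) f(x - c s) is minus the integrand of the left-hand side, and
    its integral over the half-line is minus the value at [s = 0], which is [f x]. *)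
Lemma green_by_parts (B B' : R) (f df : R -> C) (x : R) :
  (forall y : R, is_derive y 1 f (df y)) -> continuous df ->
  (forall y, `|f y| <= B) -> (forall y, `|df y| <= B') ->
  a * green f x + c%:C%C * green df x = f x :> C.
Proof.
move=> fdf cdf fB dfB.
have cf := is_derive_continuous fdf.
have mf := continuous_cmeasurable cf; have mdf := continuous_cmeasurable cdf.
have kf := green_kernel_cmeasurable x mf.
have kdf := green_kernel_cmeasurable x mdf.
have bf := green_kernel_dominated x fB.
have bdf := green_kernel_dominated x dfB.
pose H s : C := cexpN a s * f (x - c * s).
pose h s : C := - (a * (cexpN a s * f (x - c * s)) +
  c%:C%C * (cexpN a s * df (x - c * s))).
have Hh (s : R) : is_derive s 1 H (h s).
  have D := is_derive_Mc (is_derive_cexpN a s)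
    (is_derive_comp_line (fdf (x - c * s))).
  apply: (is_derive_eq D); rewrite /h scaleRcE.
  have -> : (- c)%:C%C = - c%:C%C :> C by rewrite rmorphN.
  by ring.
have ch : continuous h.
  have ckf (g : R -> C) : continuous g ->
      continuous (fun s => cexpN a s * g (x - c * s) : C).
    move=> cg; apply: continuous_Mc; first exact: continuous_cexpN.
    by move=> s; apply: (cvg_comp _ _ (@continuous_line x s)); exact: cg.
  move=> s; apply: cvgN; apply: cvgD.
    by apply: (cvg_comp _ _ (ckf _ cf s)); exact: continuous_mulc.
  by apply: (cvg_comp _ _ (ckf _ cdf s)); exact: continuous_mulc.
have hB : expN_dominated (complex.Re a) (`|a| * B + `|c%:C%C : C| * B') h.
  move=> s s0; rewrite normrN (le_trans (ler_normD _ _))// mulrDl -!mulrA.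
  by rewrite !(Rcomplex_normrM a, Rcomplex_normrM c%:C%C) lerD// ler_wpM2l// ?bf ?bdf.
have := halfline_int_derive a0 Hh ch hB bf.
have -> : h = (fun s => (- a) * (cexpN a s * f (x - c * s)) +
    (- c%:C%C) * (cexpN a s * df (x - c * s)) : C).
  by apply/funext => s; rewrite /h opprD !mulNr.
rewrite (halfline_intD a0 (cmeasurableZ _ kf) (expN_dominatedZ _ bf)
  (cmeasurableZ _ kdf) (expN_dominatedZ _ bdf)).
rewrite (halfline_intZ a0 _ kf bf) (halfline_intZ a0 _ kdf bdf).
rewrite /H cexpN0 mul1r mulr0 subr0 !mulNr -opprD => /oppr_inj.
by [].
Qed.

(** By linearity and translation invariance, the Taylor remainder of [green a c f] is the image of
    that of [f], which is uniformly of order h^2 because [ddf] is bounded. *)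
Lemma is_derive_green (B B' B'' : R) (f df ddf : R -> C) (x : R) :
  (forall y : R, is_derive y 1 f (df y)) ->
  (forall y : R, is_derive y 1 df (ddf y)) ->
  (forall y, `|f y| <= B) -> (forall y, `|df y| <= B') ->
  (forall y, `|ddf y| <= B'') ->
  is_derive x 1 (green f) (green df x).
Proof.
move=> fdf dfd fB dfB ddfB.
have mf := continuous_cmeasurable (is_derive_continuous fdf).
have mdf := continuous_cmeasurable (is_derive_continuous dfd).
apply: (@is_derive_quadratic _ _ _ (2 * ((2 * B'') / complex.Re a))) => h _.
(* The Taylor remainder of [f], written as a linear combination to which [greenD] and [greenZ]
   apply. *)
pose r y : C := f (y + h) + ((-1) * f y + (- h%:C%C) * df y).
have rE y : r y = f (y + h) - f y - h *: df y.
  by rewrite /r scaleRcE addrA mulN1r mulNr.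
have rB y : `|r y| <= (2 * B'') * h ^+ 2 by rewrite rE (taylor_is_derive fdf dfd).
have mS : cmeasurable (fun y => f (y + h)).
  by apply: cmeasurable_comp => // y; apply: cvgD; [exact: cvg_id|exact: cvg_cst].
have Zb (z : C) (k : R -> C) b : (forall y, `|k y| <= b) ->
    forall y, `|z * k y : C| <= `|z| * b.
  by move=> kb s; rewrite Rcomplex_normrM ler_wpM2l// kb.
have bD (k l : R -> C) b b' :
    (forall y, `|k y| <= b) -> (forall y, `|l y| <= b') ->
    forall y, `|k y + l y| <= b + b'.
  by move=> kb lb y; rewrite (le_trans (ler_normD _ _))// lerD.
have mZf := cmeasurableZ (-1) mf; have mZdf := cmeasurableZ (- h%:C%C) mdf.
have bZf := Zb (-1) _ _ fB; have bZdf := Zb (- h%:C%C) _ _ dfB.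
have mr : cmeasurable r by exact: cmeasurableD mS (cmeasurableD mZf mZdf).
have -> : green f (x + h) - green f x - h *: green df x = green r x.
  rewrite (greenD x mS (fun y => fB (y + h)) (cmeasurableD mZf mZdf)
    (bD _ _ _ _ bZf bZdf)).
  rewrite (greenD x mZf bZf mZdf bZdf) (greenZ _ x mf fB) (greenZ _ x mdf dfB).
  by rewrite green_shift scaleRcE addrA mulN1r mulNr.
apply: (le_trans (green_bound x mr rB)).
by rewrite le_eqVlt; apply/orP; left; apply/eqP; ring.
Qed.

End green_operator.

(** * The Green operator in the L^1 norm *)

Section green_L1.
Variable R : realType.
Local Notation C := (Rcomplex R).
Local Notation mu := (@lebesgue_measure R).
Local Notation Rp := (`[0%R, +oo[ : set R).

Lemma ge0_integral_translate (f : R -> R) (t : R) : continuous f ->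
  (forall x, 0 <= f x) ->
  (\int[mu]_x (f (x - t))%:E = \int[mu]_x (f x)%:E)%E.
Proof.
move=> cf f0; pose F x := x - t.
have DF (x : R) : is_derive x 1 F 1.
  by apply: is_derive_eq; rewrite ?oppr0 ?addr0.
have dF : F^`() = cst 1.
  by apply/funext => x; rewrite derive1E; have [_ ->] := DF x.
rewrite [RHS](@increasing_ge0_integration_by_substitutionT _ F)//.
- by apply: eq_integral => x _; rewrite /= dF /= /F; congr EFin; rewrite [RHS]mulr1.
- by move=> x y xy; rewrite /F ltrD2r.
- by rewrite dF; exact: cst_continuous.
- by rewrite dF; exact: is_cvg_cst.
- by rewrite dF; exact: is_cvg_cst.
- apply/cvgrNyPle => A; near=> x; rewrite /F lerBlDr; near: x.
  apply: nbhs_ninfty_le; exact: num_real.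
- apply/cvgryPge => A; near=> x; rewrite /F lerBrDr; near: x.
  apply: nbhs_pinfty_ge; exact: num_real.
Unshelve. all: by end_near. Qed.

(** K averages translates of [f] against an integrable weight, so Tonelli's theorem and the
    translation invariance of Lebesgue measure give the bound. The weight has integral 1 / Re a; the
    factor 2 comes from [norm_halfline_int]. *)
Lemma le_integral_norm_green (a : C) (c B : R) (f : R -> C) :
  0 < complex.Re a -> continuous f -> (forall x, `|f x| <= B) ->
  measurable_fun setT (fun x => `|green a c f x|) ->
  (\int[mu]_x (`|green a c f x|)%:E <=
   (2 / complex.Re a)%:E * \int[mu]_x (`|f x|)%:E)%E.
Proof.
move=> a0 cf fB mg; set m := complex.Re a.
have cn : continuous (fun x => `|f x|).
  by move=> x; apply: (cvg_comp _ _ (cf x)); exact: (@norm_continuous _ C).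
have mf := continuous_cmeasurable cf.
(* The indicator extends the kernel by 0 to the whole plane, so that Tonelli's theorem is applied on
   the full product. *)
pose k (z : R * R) := (expR (- m * z.2) * `|f (z.1 - c * z.2)| * \1_Rp z.2)%:E.
have k0 z : (0 <= k z)%E.
  by rewrite lee_fin mulr_ge0// mulr_ge0// expR_ge0.
have mk : measurable_fun setT k.
  apply/measurable_EFinP; apply: measurable_funM; last first.
    apply: measurableT_comp => //.
  apply: measurable_funM.
    apply: (@measurableT_comp _ _ _ _ _ _ (fun s => expR (- m * s))) => //.
    by apply: continuous_measurable_on; exact: continuous_expN.
  apply: (@measurableT_comp _ _ _ _ _ _ (fun x => `|f x|)).
    exact: continuous_measurable_on.
  by apply: measurable_funB => //; exact: measurable_funM.
have kE x : (\int[mu]_s k (x, s) =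
    \int[mu]_(s in Rp) (expR (- m * s) * `|f (x - c * s)|)%:E)%E.
  rewrite [RHS]integral_mkcond; apply: eq_integral => s _.
  rewrite /k patchE indicE /=; case: ifPn => _; rewrite ?mulr1 ?mulr0//.
have pt x : ((`|green a c f x|)%:E <= 2%:E * \int[mu]_s k (x, s))%E.
  (* A real-valued integral is the finite part of the extended one, hence 0 when that is infinite.
     Finiteness is therefore needed to pass between the two, and it follows from the bound [B]. *)
  have ik : mu.-integrable Rp (EFin \o (fun s => expR (- m * s) * `|f (x - c * s)|)).
    apply: (expN_integrable a0 (B := B)).
      apply: continuous_measurable_on => s; apply: cvgM.
        exact: continuous_expN.
      exact: (@cvg_comp _ _ _ (fun s => x - c * s) (fun y => `|f y|) _ _ _
        (@continuous_line _ c x s) (cn _)).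
    move=> s s0; rewrite normrM normr_id ger0_norm ?expR_ge0// mulrC.
    by rewrite ler_wpM2r ?expR_ge0.
  have := norm_halfline_int (green_kernel_cmeasurable a c x mf) ik.
  rewrite -lee_fin EFinM kE /Rintegral fineK; last exact: integrable_fin_num.
  by apply => s s0; rewrite Rcomplex_normrM norm_cexpN.
have mF : measurable_fun setT (fun x => \int[mu]_s k (x, s))%E.
  exact: measurable_fun_fubini_tonelli_F.
apply: (@le_trans _ _ (\int[mu]_x (2%:E * \int[mu]_s k (x, s)))%E).
  apply: ge0_le_integral => //.
  - by apply/measurable_EFinP.
  - by apply: measurable_funeM; exact: mF.
rewrite ge0_integralZl//; last by move=> x _; exact: integral_ge0.
rewrite EFinM -muleA; apply: lee_wpmul2l => //.
rewrite (fubini_tonelli (m1 := mu) (m2 := mu))//=.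
(* For fixed [s], translating by [c * s] removes the dependence of the inner integral on [s]. *)
have E s : (\int[mu]_x k (x, s) =
    (expR (- m * s) * \1_Rp s)%:E * \int[mu]_x (`|f x|)%:E)%E.
  rewrite -(ge0_integral_translate (c * s) cn)// -ge0_integralZl//.
    by apply: eq_integral => x _; rewrite /k /= -EFinM mulrAC.
  apply/measurable_EFinP; apply: continuous_measurable_on => x.
    have ct : {for x, continuous (fun x => x - c * s)}.
      by apply: cvgB; [exact: cvg_id|exact: cvg_cst].
    exact: (@cvg_comp _ _ _ (fun x => x - c * s) (fun y => `|f y|) _ _ _ ct (cn _)).
under eq_integral do rewrite E.
have W : (\int[mu]_s (expR (- m * s) * \1_Rp s)%:E = (m^-1)%:E)%E.
  rewrite -(integral_expN a0) [RHS]integral_mkcond.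
  apply: eq_integral => s _; rewrite patchE indicE.
  by case: ifPn => _; rewrite ?mulr1 ?mulr0.
rewrite ge0_integralZr//; first by rewrite W.
  apply/measurable_EFinP; apply: measurable_funM => //.
  by apply: continuous_measurable_on; exact: continuous_expN.
exact: integral_ge0.
Qed.

End green_L1.

(** * Derivatives of the Green operator and its action on D_{L^1} *)

Section smooth_green.
Variable R : realType.
Local Notation C := (Rcomplex R).
Local Notation mu := (@lebesgue_measure R).

Lemma smooth_is_derive (f : R -> C) n (x : R) : smooth f ->
  is_derive x 1 f^`(n) (f^`(n.+1) x).
Proof. by move=> sf; rewrite derive1nS derive1E; apply: derivableP; exact: sf. Qed.

Lemma smooth_continuous (f : R -> C) n : smooth f -> continuous f^`(n).
Proof.
by move=> sf; apply: is_derive_continuous => x; exact: smooth_is_derive.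
Qed.

Arguments smooth_continuous {f} n.

Lemma derive1n_unique (F : nat -> R -> C) :
  (forall n (x : R), is_derive x 1 (F n) (F n.+1 x)) ->
  smooth (F 0%N) /\ forall n, (F 0%N)^`(n) = F n.
Proof.
move=> FF; have E n : (F 0%N)^`(n) = F n.
  elim: n => // n IH; rewrite derive1nS IH; apply/funext => x.
  by rewrite derive1E; have [_ ->] := FF n x.
by split=> // n x; rewrite E; have [] := FF n x.
Qed.

(** The majorant [k] is kept apart from [df] so that both components of a complex derivative can be
    bounded by its modulus. *)
Lemma le_increment_integral (f df k : R -> R) (y : R) :
  (forall x : R, is_derive x 1 f (df x)) -> continuous df ->
  (forall x, `|df x| <= k x) -> mu.-integrable setT (EFin \o k) ->
  `|f y - f 0| <= \int[mu]_x k x.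
Proof.
move=> fdf cdf dk ik.
have H (u v : R) : u < v -> `|f v - f u| <= \int[mu]_x k x.
  move=> uv; have cf := is_derive_continuous fdf.
  have k0 x : (0 <= (k x)%:E)%E by rewrite lee_fin; exact: le_trans (dk x).
  have FTC : (\int[mu]_(x in `[u, v]) (df x)%:E = (f v)%:E - (f u)%:E)%E.
    apply: continuous_FTC2 => //.
    - exact: continuous_subspaceT.
    - split.
      + by move=> x _; have [] := fdf x.
      + exact/cvg_at_right_filter/cf.
      + exact/cvg_at_left_filter/cf.
    - by move=> x _; rewrite derive1E; have [_ ->] := fdf x.
  rewrite -lee_fin /Rintegral fineK; last exact: integrable_fin_num.
  have mdf : measurable_fun `[u, v] df by exact: continuous_measurable_on.
  have mk : measurable_fun setT k by case/integrableP : ik => /measurable_EFinP.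
  apply: (@le_trans _ _ (\int[mu]_(x in `[u, v]) `|(df x)%:E|)%E).
    rewrite (_ : (`|f v - f u|)%:E = `|(f v)%:E - (f u)%:E|%E)// -FTC.
    by apply: le_abse_integral => //; exact/measurable_EFinP.
  apply: (@le_trans _ _ (\int[mu]_(x in `[u, v]) (k x)%:E)%E).
    apply: ge0_le_integral => //.
    - by apply: measurableT_comp => //; exact/measurable_EFinP.
    - by apply/measurable_EFinP; exact: measurable_funTS.
    - by move=> x _; rewrite lee_fin.
  by apply: ge0_subset_integral => //; exact/measurable_EFinP.
have [y0|y0|->] := ltgtP y 0; [by rewrite distrC H|exact: H|].
rewrite subrr normr0; apply: Rintegral_ge0 => x _.
exact: le_trans (dk x).
Qed.

Lemma le_increment_integralc (f df : R -> C) (y : R) :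
  (forall x : R, is_derive x 1 f (df x)) -> continuous df ->
  mu.-integrable setT (EFin \o (fun x => `|df x|)) ->
  `|f y - f 0| <= 2 * \int[mu]_x `|df x|.
Proof.
move=> fdf /continuous_Rcomplex[cr ci] idf.
rewrite (le_trans (normc_ReIm _))// ReBc ImBc mulr2n mulrDl !mul1r lerD//.
  apply: (@le_increment_integral (fun x => complex.Re (f x))
    (fun x => complex.Re (df x))) => // x; last exact: normc_Re.
  by have /is_derive_Rcomplex[] := fdf x.
apply: (@le_increment_integral (fun x => complex.Im (f x))
  (fun x => complex.Im (df x))) => // x; last exact: normc_Im.
by have /is_derive_Rcomplex[] := fdf x.
Qed.

Definition all_bounded (f : R -> C) :=
  forall n, exists B : R, forall x, `|f^`(n) x| <= B.

Lemma smoothL1_smooth (psi : smoothL1 R) : smooth psi.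
Proof. by have := smoothL1P psi; rewrite inE => -[]. Qed.

Arguments smoothL1_smooth : clear implicits.

Lemma smoothL1_integrable (psi : smoothL1 R) n :
  mu.-integrable setT (EFin \o (fun x => `|derive1n n (psi : R -> C) x|)).
Proof. by have := smoothL1P psi; rewrite inE => -[_]; exact. Qed.

(** The next derivative is integrable, so the increments from 0 are bounded by twice its L^1
    norm. *)
Lemma smoothL1_bounded (psi : smoothL1 R) : all_bounded psi.
Proof.
move=> n; have sp := smoothL1_smooth psi.
exists (2 * \int[mu]_x `|derive1n n.+1 (psi : R -> C) x| +
  `|derive1n n (psi : R -> C) 0|) => x.
have := @le_increment_integralc _ _ x (fun x => smooth_is_derive n x sp)
  (smooth_continuous n.+1 sp) (smoothL1_integrable psi n.+1).
move=> /(lerD (lexx `|derive1n n (psi : R -> C) 0|)).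
rewrite [in X in _ -> X]addrC; apply: le_trans.
by rewrite -{1}(subrKC (derive1n n (psi : R -> C) 0) (derive1n n _ x)) ler_normD.
Qed.

Arguments smoothL1_bounded : clear implicits.

Section green_bounded.
Variables (a : C) (c : R) (f : R -> C).
Hypotheses (a0 : 0 < complex.Re a) (sf : smooth f) (bf : all_bounded f).

(** Differentiating [green] of the derivative of order [n] takes bounds on the orders [n], [n + 1]
    and [n + 2]; asking for all orders makes the induction go through. *)
Lemma derive1n_green_bounded : smooth (green a c f) /\
  forall n, (green a c f)^`(n) = green a c f^`(n).
Proof.
apply: (@derive1n_unique (fun n => green a c f^`(n))) => n x.
have [B fB] := bf n; have [B' fB'] := bf n.+1; have [B'' fB''] := bf n.+2.
exact: (is_derive_green c a0 x (fun y => smooth_is_derive n y sf)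
  (fun y => smooth_is_derive n.+1 y sf) fB fB' fB'').
Qed.

Lemma smooth_green : smooth (green a c f).
Proof. exact: derive1n_green_bounded.1. Qed.

Lemma derive1n_green n : (green a c f)^`(n) = green a c f^`(n).
Proof. exact: derive1n_green_bounded.2. Qed.

End green_bounded.

Section green_smoothL1.
Variables (a : C) (c : R).
Hypothesis a0 : 0 < complex.Re a.

Lemma le_integral_derive_green (psi : smoothL1 R) n :
  (\int[mu]_x (`|derive1n n (green a c psi) x|)%:E <=
  (2 / complex.Re a)%:E * \int[mu]_x (`|derive1n n (psi : R -> C) x|)%:E)%E.
Proof.
have sp := smoothL1_smooth psi; have bp := smoothL1_bounded psi.
rewrite derive1n_green//; have [B pB] := bp n.
apply: le_integral_norm_green pB _ => //; first exact: smooth_continuous.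
rewrite -derive1n_green//; apply: smooth_norm_measurable.
exact: smooth_green.
Qed.

Lemma green_smoothL1_subproof (psi : smoothL1 R) :
  (green a c psi : R -> R[i]) \in @is_smoothL1 R.
Proof.
rewrite inE /=; split.
  by apply: smooth_green => //; [exact: smoothL1_smooth|exact: smoothL1_bounded].
move=> n; apply/integrableP; split.
  apply/measurable_EFinP; apply: smooth_norm_measurable.
  by apply: smooth_green => //; [exact: smoothL1_smooth|exact: smoothL1_bounded].
under eq_integral do rewrite abse_EFin normr_id.
apply: (le_lt_trans (le_integral_derive_green psi n)).
rewrite -(fineK (integrable_fin_num _ (smoothL1_integrable psi n)))//.
by rewrite -EFinM ltry.
Qed.

Definition green_smoothL1 (psi : smoothL1 R) : smoothL1 R :=
  SmoothL1 (green_smoothL1_subproof psi).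

(** K commutes with derivatives, so no order is lost; composing a functional with K therefore keeps
    it continuous on D_{L^1}. *)
Lemma L1_norm_green (psi : smoothL1 R) m :
  L1_norm m (green_smoothL1 psi) <= (2 / complex.Re a) * L1_norm m psi.
Proof.
rewrite /L1_norm mulr_sumr; apply: ler_sum => i _.
rewrite -lee_fin EFinM /Rintegral !fineK; first exact: le_integral_derive_green.
- by apply: integrable_fin_num => //; exact: smoothL1_integrable.
- by apply: integrable_fin_num => //; exact: (smoothL1_integrable (green_smoothL1 psi)).
Qed.

Lemma smoothL1_linE (z : R[i]) (f g : smoothL1 R) (x : R) :
  (z *: f + g) x = (z : C) * f x + g x :> C.
Proof. by []. Qed.

Lemma green_smoothL1_linear : linear green_smoothL1.
Proof.
move=> z f g; apply/val_inj/funext => x.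
rewrite [RHS]smoothL1_linE /=.
have mf := continuous_cmeasurable (smooth_continuous 0 (smoothL1_smooth f)).
have mg := continuous_cmeasurable (smooth_continuous 0 (smoothL1_smooth g)).
have [Bf fB] := smoothL1_bounded f 0; have [Bg gB] := smoothL1_bounded g 0.
have fB' (y : R) : `|(z : C) * f y : C| <= `|z : C| * Bf.
  by rewrite Rcomplex_normrM ler_wpM2l// fB.
have mf' := cmeasurableZ (z : C) mf.
by rewrite -(greenZ c a0 (z : C) x mf fB) -(greenD c a0 x mf' fB' mg gB).
Qed.

Lemma smoothL1_derive_subproof (psi : smoothL1 R) :
  ((psi : R -> C)^`() : R -> R[i]) \in @is_smoothL1 R.
Proof.
rewrite inE /=; split; first exact/smooth_derive/smoothL1_smooth.
by move=> n; rewrite -derive1Sn; exact: smoothL1_integrable.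
Qed.

Definition smoothL1_derive (psi : smoothL1 R) : smoothL1 R :=
  SmoothL1 (smoothL1_derive_subproof psi).

Lemma green_smoothL1_by_parts (psi : smoothL1 R) :
  (a : R[i]) *: green_smoothL1 psi +
  c%:C%C *: green_smoothL1 (smoothL1_derive psi) = psi.
Proof.
apply/val_inj/funext => x; have sp := smoothL1_smooth psi.
have [B pB] := smoothL1_bounded psi 0; have [B' pB'] := smoothL1_bounded psi 1.
exact: (@green_by_parts _ a c a0 B B' (psi : R -> C) (psi : R -> C)^`() x
  (fun y => smooth_is_derive 0 y sp) (smooth_continuous 1 sp) pB pB').
Qed.

End green_smoothL1.

End smooth_green.

Arguments smoothL1_smooth {R} psi.
Arguments smoothL1_bounded {R} psi.
Arguments smooth_continuous {R f} n.

(** * Bounded distributions and their regularizations *)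
Section L1_functionals.
Variable R : realType.
Local Notation C := (Rcomplex R).
Local Notation mu := (@lebesgue_measure R).

Lemma L1_norm_ge0 m (f : R -> C) : 0 <= L1_norm m f.
Proof. by apply: sumr_ge0 => i _; apply: Rintegral_ge0. Qed.

Lemma derive1nZ_smooth (z : C) (f : R -> C) n : smooth f ->
  (fun x => z * f x : C)^`(n) = (fun x => z * derive1n n f x : C).
Proof.
move=> sf; have z0 : (fun=> 0 : C)^`(n) = (fun=> 0) :> (R -> C).
  by elim: n => // n IH; rewrite derive1nS IH; apply/funext => x; rewrite derive1_cst.
have := derive1n_smooth_lin (z : R[i]) sf (@smooth0 R) n.
under eq_fun do rewrite addr0.
by move=> ->; apply/funext => x; rewrite z0 addr0.
Qed.

Lemma L1_normZ m (z : R[i]) (psi : smoothL1 R) :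
  L1_norm m (z *: psi) = `|z : C| * L1_norm m psi.
Proof.
rewrite /L1_norm mulr_sumr; apply: eq_bigr => i _.
rewrite -RintegralZl//; last exact: smoothL1_integrable.
apply: eq_Rintegral => x _.
rewrite -Rcomplex_normrM; congr `| _ |.
have -> : (z *: psi : smoothL1 R) = (fun x => (z : C) * psi x) :> (R -> C) by [].
by rewrite (derive1nZ_smooth (z : C) i (smoothL1_smooth psi)).
Qed.

(** Continuity at 0 with tolerance 1 already gives the bound, by rescaling each function into the
    ball of radius [d]. *)
Lemma norms_continuous_L1P (T : {scalar (smoothL1 R)}) :
  norms_continuous (fun m (psi : smoothL1 R) => L1_norm m psi) setT T <->
  exists m B, 0 <= B /\ forall psi, `|T psi : C| <= B * L1_norm m psi.
Proof.
split=> [/(_ 0 Logic.I 1 ltr01)[m [d d0 H]]|[m [B [B0 H]]] u _ e e0].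
  exists m, d^-1; split; first by rewrite invr_ge0 ltW.
  move=> psi; rewrite mulrC; apply/ler_addgt0Pr => e e0.
  (* The scale that brings [psi] into the ball. The term [d * e] keeps the denominator positive when
     the norm is 0 and costs only [e] in the final bound. *)
  pose t := d / (L1_norm m psi + d * e).
  have N0 := L1_norm_ge0 m psi.
  have Np : 0 < L1_norm m psi + d * e by rewrite ltr_wpDl// mulr_gt0.
  have t0 : 0 < t by rewrite divr_gt0.
  have nt : `|t%:C%C : C| = t.
    by rewrite Rcomplex_normE /= expr0n addr0 sqrtr_sqr gtr0_norm.
  have := H (t%:C%C *: psi) Logic.I.
  rewrite subr0 linear0 subr0 L1_normZ nt linearZ /= Rcomplex_normrM nt.
  have lt : t * L1_norm m psi < d.
    rewrite /t mulrAC ltr_pdivrMr// ltr_pM2l// ltrDl mulr_gt0//.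
  move=> /(_ lt); rewrite mulrC -ltr_pdivlMr// mul1r => /ltW.
  by rewrite /t invf_div mulrDl mulrAC divff ?gt_eqF// mul1r.
exists m, (e / (B + 1)); first by rewrite divr_gt0// ltr_wpDl.
move=> v _ uv; rewrite -(linearB T) (le_lt_trans (H _))//.
have B1 : 0 < B + 1 by rewrite ltr_wpDl.
apply: (@le_lt_trans _ _ ((B + 1) * L1_norm m (v - u))).
  by rewrite ler_wpM2r ?L1_norm_ge0// lerDl.
by rewrite mulrC -ltr_pdivlMr.
Qed.

(** Bounded distributions as plain functions with an explicit bound, so that constructions need not
    carry continuity on D; [L1_functional_distrib] recovers it. *)
Definition L1_functional (T : testfun R -> R[i]) :=
  exists2 T1 : {scalar (smoothL1 R)},
    (exists m B, 0 <= B /\ forall psi, `|T1 psi : C| <= B * L1_norm m psi) &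
    forall phi, T phi = T1 (testfun_smoothL1 phi).

Lemma bounded_distribP (T : distrib R) : bounded_distrib T <-> L1_functional T.
Proof. by split=> -[T1 /norms_continuous_L1P H E]; exists T1. Qed.

Lemma testfun_smoothL1_linear : linear (@testfun_smoothL1 R).
Proof. by move=> z f g; exact/val_inj. Qed.

Lemma L1_functional_linear T : L1_functional T ->
  forall z f g, T (z *: f + g) = z * T f + T g.
Proof.
move=> [T1 _ E] z f g; rewrite !E testfun_smoothL1_linear.
exact: linearP.
Qed.

(** Each of the m + 1 integrals lives on the interval. Only its length enters, which makes the bound
    uniform over translates. *)
Lemma le_L1_norm_compact (m : nat) (f : R -> C) (u v B : R) : u <= v ->
  smooth f ->
  (forall i y, ~ (u <= y <= v) -> derive1n i f y = 0) ->
  (forall i y, (i <= m)%N -> `|derive1n i f y| <= B) ->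
  L1_norm m f <= m.+1%:R * ((v - u) * B).
Proof.
move=> uv sf f0 fB; rewrite /L1_norm -[m.+1 in leRHS]card_ord.
rewrite mulr_natl -sumr_const; apply: ler_sum => i _.
have -> : \int[mu]_x `|derive1n i f x| = \int[mu]_(x in `[u, v]) `|derive1n i f x|.
  rewrite [RHS]Rintegral_mkcond; apply: eq_Rintegral => x _.
  rewrite patchE; case: ifPn => // /negP xuv; rewrite f0 ?normr0// => uxv.
  by apply: xuv; rewrite inE /= in_itv.
have -> : (v - u) * B = \int[mu]_(x in `[u, v]) B.
  rewrite Rintegral_cst// mulrC; congr (_ * _).
  have L : lebesgue_measure (`[u, v] : set R) = (v - u)%:E.
    rewrite lebesgue_measure_itv /= lte_fin.
    by case: ltgtP uv => // ->; rewrite ?subrr.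
  by rewrite -[LHS]/(fine (v - u)%:E) -L.
apply: le_Rintegral => //.
- apply: continuous_compact_integrable; first exact: segment_compact.
  by apply: continuous_subspaceT; exact: smooth_norm_continuous.
- apply: continuous_compact_integrable; first exact: segment_compact.
  by apply: continuous_subspaceT; exact: cst_continuous.
- by move=> x _; apply: fB; rewrite -ltnS.
Qed.

Lemma testfun_smooth (phi : testfun R) : smooth phi.
Proof. by have := testfunP phi; rewrite inE => -[]. Qed.
Arguments testfun_smooth : clear implicits.

Lemma testfun_support (phi : testfun R) : exists2 M : R, 0 <= M &
  forall i x, M < `|x| -> derive1n i (phi : R -> C) x = 0.
Proof.
have := testfunP phi; rewrite inE => -[_ /compact_supportP[M H]].
exists `|M| => // i; apply: derive1n_support => x Mx; apply: H.
by rewrite (le_lt_trans _ Mx)// ler_norm.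
Qed.

Lemma testfun_bounded_upto (phi : testfun R) m : exists2 B : R, 0 <= B &
  forall i x, (i <= m)%N -> `|derive1n i (phi : R -> C) x| <= B.
Proof.
have bp := smoothL1_bounded (testfun_smoothL1 phi).
elim: m => [|m [B B0 H]].
  have [B HB] := bp 0%N; exists B; first exact: le_trans (HB 0).
  by move=> i x; rewrite leqn0 => /eqP ->; exact: HB.
have [B' HB'] := bp m.+1.
exists (Num.max B B'); first by rewrite le_max B0.
move=> i x; rewrite leq_eqVlt => /orP[/eqP ->|im].
  by rewrite le_max HB' orbT.
by rewrite le_max H.
Qed.

(** The reflected test function is supported in an interval around [x] whose length does not depend
    on [x], and its derivatives are those of [phi] up to sign. *)
Lemma distrib_conv_bounded (T : testfun R -> R[i]) (phi : testfun R) :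
  L1_functional T -> exists B : R, forall x, `|distrib_conv T phi x : C| <= B.
Proof.
move=> [T1 [m [B [B0 H]]] E].
have [M M0 phiM] := testfun_support phi.
have [K K0 phiK] := testfun_bounded_upto phi m.
exists (B * (m.+1%:R * ((M *+ 2) * K))) => x.
rewrite /distrib_conv E (le_trans (H _))// ler_wpM2l//.
have -> : M *+ 2 = (x + M) - (x - M) by ring.
apply: le_L1_norm_compact; first lra.
- exact: (testfun_smooth (testfun_reflect x phi)).
- move=> i y yM; rewrite /= (derive1n_reflect x i (testfun_smooth phi)).
  rewrite phiM ?scaler0// ltNge; apply/negP; rewrite ler_norml => ?.
  by apply: yM; lra.
- move=> i y im; rewrite /= (derive1n_reflect x i (testfun_smooth phi)).
  by rewrite normrZ normrX normrN1 expr1n mul1r phiK.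
Qed.

(** [T] is applied to the Taylor remainder of the reflected test function in the parameter [x],
    whose norm of order [m] is of order h^2. *)
Lemma is_derive_distrib_conv (T : testfun R -> R[i]) (phi : testfun R) (x : R) :
  L1_functional T ->
  is_derive x 1 (distrib_conv T phi : R -> C)
    (distrib_conv T (testfun_derive phi) x).
Proof.
move=> LT; have lT := L1_functional_linear LT.
move: LT => [T1 [m [B [B0 H]]] E].
have [M M0 phiM] := testfun_support phi.
have [K K0 phiK] := testfun_bounded_upto phi m.+2.
have sp := testfun_smooth phi.
(* For |h| at most 1 the remainder is supported in an interval of length 2 (M + 1), and [2 * K] is
   its Taylor constant for derivatives up to order [m]; this is why [K] covers the orders up to
   [m.+2]. *)
apply: (@is_derive_quadratic _ _ _
  (B * (m.+1%:R * (((M + 1) *+ 2) * (2 * K))))) => h h1.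
pose r1 := testfun_reflect (x + h) phi.
pose r2 := testfun_reflect x phi.
pose r3 := testfun_reflect x (testfun_derive phi).
pose v : testfun R := (-1) *: r2 + ((- h%:C%C) *: r3 + r1).
have -> : distrib_conv T phi (x + h) - distrib_conv T phi x -
    h *: (distrib_conv T (testfun_derive phi) x : C) = T v :> C.
  by rewrite scaleRcE /distrib_conv !lT mulN1r mulNr -/r1 -/r2 -/r3; ring.
(* Up to the sign due to the reflection, a derivative of [v] is the Taylor remainder of the same
   derivative of [phi]. *)
have vE i y : derive1n i (v : R -> C) y = (-1) ^+ i *:
    (derive1n i (phi : R -> C) (x - y + h) - derive1n i (phi : R -> C) (x - y) -
    h *: derive1n i.+1 (phi : R -> C) (x - y)).
  have s1 := testfun_smooth r1; have s2 := testfun_smooth r2.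
  have s3 := testfun_smooth r3.
  have -> : (v : R -> C) = (fun y => (-1) * r2 y + ((- h%:C%C) * r3 y + r1 y)).
    by [].
  rewrite (derive1n_smooth_lin (-1) s2 (smooth_lin (a := - h%:C%C) s3 s1)).
  rewrite (derive1n_smooth_lin (- h%:C%C) s3 s1) /=.
  rewrite (derive1n_reflect x i sp) (derive1n_reflect (x + h) i sp).
  rewrite (derive1n_reflect x i (smooth_derive sp)) -derive1Sn.
  rewrite (_ : x + h - y = x - y + h); last by ring.
  rewrite mulN1r mulNr -[X in _ + (- X + _)]scaleRcE -?derive1nS.
  rewrite scalerA (mulrC h) -scalerA !scalerBr.
  by rewrite addrA addrC addrA.
rewrite E (le_trans (H _))// -!mulrA ler_wpM2l//.
have -> : m.+1%:R * ((M + 1) *+ 2 * (2 * (K * h ^+ 2))) =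
  m.+1%:R * (((x + (M + 1)) - (x - (M + 1))) * (2 * K * h ^+ 2)) by ring.
apply: le_L1_norm_compact.
- lra.
- exact: (testfun_smooth v).
- move=> i y yM; rewrite vE.
  have xy : M + 1 < `|x - y|.
    by rewrite ltNge; apply/negP; rewrite ler_norml => ?; apply: yM; lra.
  have xyh : M < `|x - y + h|.
    by have := ler_normB (x - y + h) h; rewrite addrK; lra.
  by rewrite !phiM ?scaler0 ?subr0 ?scaler0//; lra.
- move=> i y im; rewrite vE normrZ normrX normrN1 expr1n mul1r.
  apply: (taylor_is_derive (fun z => smooth_is_derive i z sp)
    (fun z => smooth_is_derive i.+1 z sp)) => z.
  by apply: phiK.
Qed.

End L1_functionals.

Arguments testfun_smooth {R} phi.

(** * Stability of almost automorphy *)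

Section almost_automorphic_functions.
Variable R : realType.
Local Notation C := (Rcomplex R).

Lemma cvg_homo_nat (k : nat -> nat) : {homo k : m n / (m < n)%N} ->
  k n @[n --> \oo] --> \oo.
Proof.
move=> kk; have le_k n : (n <= k n)%N.
  by elim: n => // n /leq_ltn_trans; apply; exact: kk.
apply/cvgnyPge => A; exists A => // n /= An; exact: leq_trans (le_k n).
Qed.

(** A subsequence is extracted for [f], and from it a further one for [g]; the limits for [f]
    persist along the latter. *)
Lemma almost_automorphic_lin (z : C) (f g : R -> C) :
  almost_automorphic f -> almost_automorphic g ->
  almost_automorphic (fun x => z * f x + g x : C).
Proof.
move=> [cf Hf] [cg Hg].
have L (T : Type) (F : set_system T) (FF : Filter F) (u v : T -> C) (p q : C) :
    u @ F --> p -> v @ F --> q ->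
    (fun t => z * u t + v t : C) @ F --> (z * p + q : C).
  move=> up vq; apply: (@cvgD _ C) => //.
  by apply: (cvg_comp _ _ up); exact: continuous_mulc.
split; first by move=> x; exact: (L _ _ _ _ _ _ _ (cf x) (cg x)).
move=> s; have [k kk [f' ff' f'f]] := Hf s.
have [l ll [g' gg' g'g]] := Hg (s \o k).
exists (k \o l); first by move=> m n mn; exact/kk/ll.
exists (fun x => z * f' x + g' x : C) => x.
  apply: L; last exact: gg'.
  exact: (cvg_comp _ _ (cvg_homo_nat ll) (ff' x)).
apply: L; last exact: g'g.
exact: (cvg_comp _ _ (cvg_homo_nat ll) (f'f x)).
Qed.

Lemma almost_automorphic0 : almost_automorphic (fun=> 0 : C).
Proof.
split; first exact: cst_continuous.
move=> s; exists id => //; exists (fun=> 0) => x; exact: cvg_cst.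
Qed.

(** The subsequence chosen for [f] also serves [green a c f], with limit [green a c g]. As a
    pointwise limit, [g] is measurable and inherits the bound [B], so dominated convergence applies
    in both directions. *)
Lemma almost_automorphic_green (a : C) (c B : R) (f : R -> C) :
  0 < complex.Re a -> (forall x, `|f x| <= B) -> almost_automorphic f ->
  continuous (green a c f) -> almost_automorphic (green a c f).
Proof.
move=> a0 fB [cf Hf] cgf; split=> // s.
have [k kk [g fg gf]] := Hf s.
have mf := continuous_cmeasurable cf.
have mS (h : R -> C) (t : R) : cmeasurable h -> cmeasurable (fun x => h (x + t)).
  move=> mh; apply: cmeasurable_comp => // y.
  by apply: cvgD; [exact: cvg_id|exact: cvg_cst].
have mg : cmeasurable g by apply: cmeasurable_cvg fg => n; exact: mS.
have gB x : `|g x| <= B.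
  have nc : (`|f (x + s (k n))|) @[n --> \oo] --> `|g x|.
    by apply: (cvg_comp _ _ (fg x)); exact: (@norm_continuous _ C).
  rewrite -(cvg_lim _ nc)//; apply: limr_le; first by apply/cvg_ex; exists `|g x|.
  by apply: nearW => n; exact: fB.
exists k => //; exists (green a c g) => x.
  under eq_fun do rewrite -green_shift.
  by apply: (@green_cvg _ a c a0 B (fun n y => f (y + s (k n)))) => // n; exact: mS.
under eq_fun do rewrite -green_shift.
by apply: (@green_cvg _ a c a0 B (fun n y => g (y - s (k n)))) => // n; exact: mS.
Qed.

End almost_automorphic_functions.

(** * Constructions on D_{L^1} functionals and their restriction to distributions *)

Section functional_constructions.
Variable R : realType.
Local Notation C := (Rcomplex R).

Section restriction.
Variable T1 : {scalar (smoothL1 R)}.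

Definition restrict_testfun (phi : testfun R) : R[i] := T1 (testfun_smoothL1 phi).

Lemma restrict_testfun_is_scalar : scalar restrict_testfun.
Proof.
by move=> z f g; rewrite /restrict_testfun testfun_smoothL1_linear linearP.
Qed.

HB.instance Definition _ := GRing.isLinear.Build R[i] (testfun R) R[i] *%R
  restrict_testfun restrict_testfun_is_scalar.

End restriction.

Section combination.
Variables (z : R[i]) (T1 T2 : {scalar (smoothL1 R)}).

Definition lin_functional (psi : smoothL1 R) : R[i] := z * T1 psi + T2 psi.

Lemma lin_functional_is_scalar : scalar lin_functional.
Proof. by move=> k f g; rewrite /lin_functional !linearP /=; ring. Qed.

HB.instance Definition _ := GRing.isLinear.Build R[i] (smoothL1 R) R[i] *%R
  lin_functional lin_functional_is_scalar.

End combination.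

Section green_dual.
Variables (a : C) (c : R) (a0 : 0 < complex.Re a) (T1 : {scalar (smoothL1 R)}).

Definition green_dual (psi : smoothL1 R) : R[i] := T1 (green_smoothL1 c a0 psi).

Lemma green_dual_is_scalar : scalar green_dual.
Proof.
by move=> z f g; rewrite /green_dual green_smoothL1_linear linearP.
Qed.

HB.instance Definition _ := GRing.isLinear.Build R[i] (smoothL1 R) R[i] *%R
  green_dual green_dual_is_scalar.

End green_dual.

Lemma L1_norm_mono m n (f : R -> C) : (m <= n)%N -> L1_norm m f <= L1_norm n f.
Proof.
move=> mn; rewrite /L1_norm -!(big_mkord xpredT
  (fun i => \int[lebesgue_measure]_x `|derive1n i f x|)).
rewrite [leRHS](@big_cat_nat _ _ _ m.+1)//= lerDl.
by apply: sumr_ge0 => i _; apply: Rintegral_ge0.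
Qed.

Lemma L1_functional_lin (z : R[i]) T S : L1_functional T -> L1_functional S ->
  @L1_functional R (fun phi => z * T phi + S phi).
Proof.
move=> [T1 [m [B [B0 HT]]] ET] [S1 [n [D [D0 HS]]] ES].
exists (lin_functional z T1 S1); last by move=> phi; rewrite ET ES.
exists (maxn m n), (`|z : C| * B + D); split; first by rewrite addr_ge0// mulr_ge0.
move=> psi; rewrite /= /lin_functional (le_trans (ler_normD (_ : C) _))//.
rewrite mulrDl lerD//.
  rewrite Rcomplex_normrM -mulrA ler_wpM2l// (le_trans (HT _))// ler_wpM2l//.
  by rewrite L1_norm_mono// leq_maxl.
by rewrite (le_trans (HS _))// ler_wpM2l// L1_norm_mono// leq_maxr.
Qed.

Lemma L1_functional0 : @L1_functional R (fun=> 0).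
Proof.
exists (GRing.null_fun _ : {scalar (smoothL1 R)}) => //.
by exists 0%N, 0; split=> // psi; rewrite mul0r normr0.
Qed.

(** A real [sup] dominates only a set that is bounded above, which the boundedness of functions in
    D_{L^1} provides. *)
Lemma sup_norm_ge (phi : testfun R) m i x : (i <= m)%N ->
  `|derive1n i (phi : R -> C) x| <= sup_norm m phi.
Proof.
move=> im; have bp := smoothL1_bounded (testfun_smoothL1 phi).
have ub j y : `|derive1n j (phi : R -> C) y| <=
    sup (range (fun x => `|derive1n j (phi : R -> C) x|)).
  apply: ub_le_sup; last by exists y.
  by have [B HB] := bp j; exists B => _ [t _ <-]; exact: HB.
rewrite /sup_norm (bigD1 (Ordinal (im : (i < m.+1)%N)))//=.
rewrite (le_trans (ub i x))// lerDl; apply: sumr_ge0 => j _.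
exact: le_trans (ub j 0).
Qed.

(** On functions supported in a fixed compact set, the L^1 norms are bounded by the sup norms times
    the length of an enclosing interval. *)
Lemma L1_functional_distrib T : L1_functional T ->
  exists U : distrib R, forall phi, U phi = T phi.
Proof.
move=> LT; have [T1 [m [B [B0 H]]] E] := LT.
suff K (K : set R) : compact K ->
    norms_continuous (fun m (phi : testfun R) => sup_norm m phi)
      [set phi : testfun R | closure [set x | phi x != 0] `<=` K]
      (restrict_testfun T1).
  by exists (Distrib K) => phi; rewrite E.
move=> /compact_bounded[M [Mreal KM]] u Ku e e0.
(* [compact_bounded] bounds the set only by numbers strictly above [M], and the half-length of the
   interval must be positive. *)
pose L := `|M| + 1.
have L0 : 0 < L by rewrite ltr_wpDl.
have supp (phi : testfun R) : closure [set x | phi x != 0] `<=` K ->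
    forall x, L < `|x| -> phi x = 0.
  move=> Kp x Lx; apply/eqP; apply: contraT => px.
  have : K x by apply: Kp; exact: subset_closure.
  have ML : M < L by rewrite /L (le_lt_trans (ler_norm _))// ltrDl.
  by move=> /(KM L ML) /=; rewrite leNgt Lx.
pose Q := B * (m.+1%:R * (L *+ 2)).
have Q0 : 0 <= Q by rewrite !mulr_ge0// mulrn_wge0// ltW.
(* [Q] is 0 when [B] is, hence the divisor [Q + 1]. *)
exists m, (e / (Q + 1)); first by rewrite divr_gt0// ltr_wpDl.
move=> v Kv uv; rewrite -linearB /restrict_testfun.
apply: (le_lt_trans (H _)).
have N : L1_norm m (testfun_smoothL1 (v - u)) <=
    m.+1%:R * ((L - (- L)) * sup_norm m (v - u)).
  apply: le_L1_norm_compact; first lra.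
  - exact: (testfun_smooth (v - u)).
  - move=> i y yL; apply: (@derive1n_support _ _ L).
      move=> x Lx; have : (v - u) x = v x - u x by [].
      by rewrite (supp v)// (supp u)// subrr.
    by rewrite ltNge; apply/negP; rewrite ler_norml.
  - by move=> i y im; exact: sup_norm_ge.
have Q1 : 0 < Q + 1 by rewrite ltr_wpDl.
apply: (le_lt_trans (ler_wpM2l B0 N)).
have -> : B * (m.+1%:R * ((L - - L) * sup_norm m (v - u))) =
  Q * sup_norm m (v - u) by rewrite /Q; ring.
have S0 : 0 <= sup_norm m (v - u).
  by apply: le_trans (@sup_norm_ge (v - u) m 0 0 _).
apply: (@le_lt_trans _ _ ((Q + 1) * sup_norm m (v - u))).
  by rewrite ler_wpM2r// lerDl.
by rewrite mulrC -ltr_pdivlMr.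
Qed.

End functional_constructions.

(** * Scalar equations *)
Section scalar_equation.
Variable R : realType.
Local Notation C := (Rcomplex R).

Lemma derive_testfun_reflect (x : R) (phi : testfun R) :
  testfun_derive (testfun_reflect x phi) =
  - testfun_reflect x (testfun_derive phi).
Proof.
apply/val_inj/funext => y /=.
have sp := testfun_smooth phi.
have := is_derive_reflect (sp 0%N (x - y)) => -[_ H].
by rewrite derive1E H.
Qed.

(** The sign from differentiating y |-> phi(x - y) cancels the one in the distributional
    derivative. *)
Lemma distrib_conv_ode (lam : C) (U T : testfun R -> R[i]) (phi : testfun R)
    (x : R) : L1_functional U ->
  (forall psi, distrib_derive U psi = lam * U psi + T psi) ->
  distrib_conv U (testfun_derive phi) x =
  lam * distrib_conv U phi x + distrib_conv T phi x :> C.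
Proof.
move=> LU UT; rewrite /distrib_conv -UT /distrib_derive derive_testfun_reflect.
have := L1_functional_linear LU (-1) (testfun_reflect x (testfun_derive phi)) 0.
have -> : U 0 = 0.
  by have := L1_functional_linear LU (-1) 0 0; rewrite scaler0 addr0 mulN1r addNr.
by rewrite !addr0 scaleN1r mulN1r => ->; rewrite opprK.
Qed.

Definition aa_functional (T : testfun R -> R[i]) :=
  L1_functional T /\
  forall phi, almost_automorphic (distrib_conv T phi : R -> C).

Section hyperbolic.
Variables (lam : C).
Hypothesis lam0 : complex.Re lam != 0.
Let c : R := Num.sg (complex.Re lam).
Let a : C := c%:C%C * lam.

Let a0 : 0 < complex.Re a.
Proof. by rewrite ReMc /= mul0r subr0 /c -normrEsg normr_gt0. Qed.

Let cc : c%:C%C * c%:C%C = 1 :> C.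
Proof. by rewrite -rmorphM -expr2 sqr_sg lam0 rmorph1. Qed.

(** For v = U * phi, integration by parts in the direction [- c] reads a K' v - c K' v' = v.
    Substituting v' = lam v + T * phi cancels the terms in K' v, since a = c lam. Boundedness of v
    and v' is enough for this. *)
Lemma distrib_conv_green (U T : testfun R -> R[i]) (phi : testfun R) (x : R) :
  L1_functional U -> L1_functional T ->
  (forall psi, distrib_derive U psi = lam * U psi + T psi) ->
  distrib_conv U phi x = - c%:C%C * green a (- c) (distrib_conv T phi) x :> C.
Proof.
move=> LU LT UT.
have [B uB] := distrib_conv_bounded phi LU.
have [B' duB] := distrib_conv_bounded (testfun_derive phi) LU.
have [B'' fB] := distrib_conv_bounded phi LT.
have du := fun y => is_derive_distrib_conv phi y LU.
have cu := is_derive_continuous du.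
have cdu := is_derive_continuous
  (fun y => is_derive_distrib_conv (testfun_derive phi) y LU).
have cf := is_derive_continuous (fun y => is_derive_distrib_conv phi y LT).
have := green_by_parts (- c) a0 x du cdu uB duB.
have mu := continuous_cmeasurable cu; have mf := continuous_cmeasurable cf.
have luB (y : R) : `|lam * distrib_conv U phi y : C| <= `|lam| * B.
  by rewrite Rcomplex_normrM ler_wpM2l.
rewrite (_ : distrib_conv U (testfun_derive phi) =
  (fun y => lam * distrib_conv U phi y + distrib_conv T phi y)); last first.
  by apply/funext => y; exact: distrib_conv_ode.
rewrite (greenD (- c) a0 x (cmeasurableZ lam mu) luB mf fB).
rewrite (greenZ (- c) a0 lam x mu uB) => <-.
have -> : (- c)%:C%C = - c%:C%C :> C by rewrite rmorphN.
rewrite /a; ring.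
Qed.

Lemma scalar_equation_unique (U : testfun R -> R[i]) : L1_functional U ->
  (forall psi, distrib_derive U psi = lam * U psi) -> forall phi, U phi = 0.
Proof.
move=> LU UE phi.
have z0 : distrib_conv (fun=> 0) (testfun_reflect 0 phi) = (fun=> 0) :> (R -> C).
  by [].
(* [U phi] is the value at 0 of the regularization of [U] by the reflected [phi], so the formula for
   regularizations determines [U]. *)
have -> : phi = testfun_reflect 0 (testfun_reflect 0 phi).
  by apply/val_inj/funext => y /=; rewrite !sub0r opprK.
rewrite -[LHS]/(distrib_conv U (testfun_reflect 0 phi) 0).
have UE' psi : distrib_derive U psi = lam * U psi + 0 by rewrite UE addr0.
rewrite (distrib_conv_green _ _ LU (@L1_functional0 R) UE') z0.
have m0 : cmeasurable (fun=> 0 : C).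
  exact/continuous_cmeasurable/cst_continuous.
have b0 (y : R) : `|0 : C| <= 0 :> R by rewrite normr0.
have := green_bound (- c) a0 0 m0 b0.
by rewrite mul0r mulr0 normr_le0 => /eqP ->; rewrite mulr0.
Qed.

(** The solution is defined by duality, with K acting on test functions. Once it is known to be a
    bounded solution, [distrib_conv_green] computes its regularizations, so the convolution is never
    unfolded directly. *)
Lemma scalar_equation_solvable (T : testfun R -> R[i]) : aa_functional T ->
  exists2 U, aa_functional U &
    forall phi, distrib_derive U phi = lam * U phi + T phi.
Proof.
move=> [LT aaT]; have [T1 [m [B [B0 H]]] E] := LT.
pose G (phi : testfun R) := T1 (green_smoothL1 c a0 (testfun_smoothL1 phi)).
pose U (phi : testfun R) : R[i] := - c%:C%C * G phi.
have UT phi : distrib_derive U phi = lam * U phi + T phi.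
  have GE : T1 (testfun_smoothL1 phi) =
      a * G phi + c%:C%C * G (testfun_derive phi).
    rewrite -[in LHS](green_smoothL1_by_parts c a0 (testfun_smoothL1 phi)).
    rewrite linearP /=; congr (_ + _).
    have -> : smoothL1_derive (testfun_smoothL1 phi) =
        testfun_smoothL1 (testfun_derive phi) by exact/val_inj.
    exact: linearZ.
  rewrite /distrib_derive /U E GE /a; ring.
have LG : L1_functional G.
  exists (green_dual c a0 T1) => //.
  exists m, (B * (2 / complex.Re a)); split; first by rewrite mulr_ge0// divr_ge0// ltW.
  move=> psi; rewrite (le_trans (H _))// -mulrA ler_wpM2l//.
  exact: L1_norm_green.
have LU : L1_functional U.
  have := L1_functional_lin (- c%:C%C) LG (@L1_functional0 R).
  by under eq_fun do rewrite addr0.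
exists U => //; split=> // phi.
(* The added 0 gives the shape of [almost_automorphic_lin]. *)
have UE : (distrib_conv U phi : R -> C) =
    (fun x => - c%:C%C * green a (- c) (distrib_conv T phi) x + 0 : C).
  by apply/funext => x; rewrite addr0 (distrib_conv_green _ _ LU LT UT).
rewrite UE; apply: almost_automorphic_lin (almost_automorphic0 R).
have [D TD] := distrib_conv_bounded phi LT.
apply: (almost_automorphic_green a0 TD) => //.
have cU := is_derive_continuous (fun y => is_derive_distrib_conv phi y LU).
(* Since c^2 = 1, the formula can be inverted, and continuity is inherited from the regularization
   of [U]. *)
have -> : green a (- c) (distrib_conv T phi) =
    (fun x => - c%:C%C * distrib_conv U phi x : C).
  apply/funext => x; rewrite (distrib_conv_green _ _ LU LT UT).
  by rewrite mulrA mulrNN cc mul1r.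
by move=> x; apply: (cvg_comp _ _ (cU x)); exact: continuous_mulc.
Qed.

End hyperbolic.
End scalar_equation.

(** * Systems *)
Section systems.
Variables (R : realType) (n : nat) (A : 'M[R[i]]_n.+1).
Local Notation vec := (testfun R -> 'cV[R[i]]_n.+1).

Definition coord_all (P : (testfun R -> R[i]) -> Prop) (V : vec) :=
  forall i, P (fun phi => V phi i 0).

(** The subspace property, so that bounded and almost automorphic functionals share the closure
    lemmas for vectors. *)
Definition lin_closed (P : (testfun R -> R[i]) -> Prop) :=
  P (fun=> 0) /\
  forall z T S, P T -> P S -> P (fun phi => z * T phi + S phi).

Lemma coord_all_mulmx P (M : 'M[R[i]]_n.+1) (V : vec) : lin_closed P ->
  coord_all P V -> coord_all P (fun phi => M *m V phi).
Proof.
move=> [P0 PL] PV i; under eq_fun do rewrite mxE.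
elim: (index_enum _) => [|j s IH]; first by under eq_fun do rewrite big_nil.
by under eq_fun do rewrite big_cons; exact: PL.
Qed.

Lemma coord_allD P (V W : vec) : lin_closed P ->
  coord_all P V -> coord_all P W -> coord_all P (fun phi => V phi + W phi).
Proof.
move=> [_ PL] PV PW i; under eq_fun do rewrite mxE -[X in X + _]mul1r.
exact: PL (PV i) (PW i).
Qed.

Lemma lin_closed_L1_functional : lin_closed (@L1_functional R).
Proof. by split=> [|z T S]; [exact: L1_functional0|exact: L1_functional_lin]. Qed.

Lemma lin_closed_aa_functional : lin_closed (@aa_functional R).
Proof.
split=> [|z T S [LT aT] [LS aS]].
  by split=> [|phi]; [exact: L1_functional0|exact: almost_automorphic0].
split=> [|phi]; first exact: L1_functional_lin.
exact: almost_automorphic_lin (aT phi) (aS phi).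
Qed.

(** Putzer's product, for an arbitrary list because the inductions remove one factor at a time. *)
Definition spectral_prod (ls : seq R[i]) : 'M[R[i]]_n.+1 :=
  \prod_(z <- ls) (A - z%:M).

Lemma comm_spectral_prod ls : A *m spectral_prod ls = spectral_prod ls *m A.
Proof.
apply: commr_prod => z _.
by apply: commrB; [exact: commr_refl|exact: comm_mx_scalar].
Qed.

Lemma coord_scalar_unique (z : R[i]) (V : vec) : complex.Re z != 0 ->
  coord_all (@L1_functional R) V ->
  (forall phi, - V (testfun_derive phi) = z *: V phi) -> forall phi, V phi = 0.
Proof.
move=> z0 LV VE phi; apply/colP => i; rewrite [RHS]mxE.
apply: (@scalar_equation_unique R z z0 (fun phi => V phi i 0)) => // psi.
by have /colP/(_ i) := VE psi; rewrite !mxE.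
Qed.

(** (A - z) V solves the same system and is annihilated by the remaining factors, so it vanishes by
    induction. Then A V = z V, and each coordinate of [V] solves a scalar homogeneous equation. *)
Lemma homogeneous_system_unique (ls : seq R[i]) (V : vec) :
  {in ls, forall z, complex.Re z != 0} ->
  coord_all (@L1_functional R) V ->
  (forall phi, - V (testfun_derive phi) = A *m V phi) ->
  (forall phi, spectral_prod ls *m V phi = 0) -> forall phi, V phi = 0.
Proof.
elim: ls V => [|z ls IH] V ls0 LV VE.
  by move=> H phi; have := H phi; rewrite /spectral_prod big_nil mul1mx.
have zls : (A - z%:M) *m spectral_prod ls = spectral_prod ls *m (A - z%:M).
  rewrite mulmxBl mulmxBr comm_spectral_prod; congr (_ - _).
  by rewrite scalar_mxC.
rewrite /spectral_prod big_cons -/(spectral_prod ls) => H.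
have W0 phi : (A - z%:M) *m V phi = 0.
  apply: (IH (fun phi => (A - z%:M) *m V phi)) => [w wl||psi|psi].
  - by apply: ls0; rewrite inE wl orbT.
  - exact: coord_all_mulmx lin_closed_L1_functional LV.
  - rewrite -mulmxN VE !mulmxA; congr (_ *m _).
    by rewrite mulmxBl mulmxBr scalar_mxC.
  - by rewrite mulmxA -zls; exact: H.
apply: (coord_scalar_unique (ls0 z (mem_head _ _)) LV) => phi.
rewrite VE; apply/eqP; rewrite -subr_eq0 -mul_scalar_mx -mulmxBl.
by rewrite W0.
Qed.

Lemma system_solvable (ls : seq R[i]) (W : vec) :
  {in ls, forall z, complex.Re z != 0} ->
  coord_all (@aa_functional R) W ->
  (forall phi, spectral_prod ls *m W phi = 0) ->
  exists2 U : vec, coord_all (@aa_functional R) U &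
    forall phi, - U (testfun_derive phi) = A *m U phi + W phi.
Proof.
elim: ls W => [|z ls IH] W ls0 aW H.
  (* The empty product is the identity, so here [W] is 0. *)
  exists (fun=> 0).
    by move=> i; under eq_fun do rewrite mxE; case: lin_closed_aa_functional.
  move=> phi; have := H phi; rewrite /spectral_prod big_nil mul1mx => ->.
  by rewrite oppr0 mulmx0 addr0.
have z0 := ls0 z (mem_head _ _).
have /choice[r Hr] : forall i, exists u : testfun R -> R[i], aa_functional u /\
    forall phi, distrib_derive u phi = z * u phi + W phi i 0.
  by move=> i; have [u] := scalar_equation_solvable z0 (aW i); exists u.
pose V : vec := fun phi => \col_i r i phi.
have aV : coord_all (@aa_functional R) V.
  by move=> i; under eq_fun do rewrite mxE; have [] := Hr i.
have VE phi : - V (testfun_derive phi) = z *: V phi + W phi.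
  apply/colP => i; have [_ E] := Hr i; rewrite !mxE -E.
  by [].
have LM M V' : coord_all (@aa_functional R) V' ->
    coord_all (@L1_functional R) (fun phi => M *m V' phi).
  move=> aV'; apply: coord_all_mulmx lin_closed_L1_functional _ => i.
  by have [] := aV' i.
(* The full product annihilates [W], so its image of [V] is a bounded solution of the scalar
   homogeneous equation and vanishes by uniqueness. This is what the induction needs for the new
   right-hand side (A - z) V. *)
have PV phi : spectral_prod (z :: ls) *m V phi = 0.
  apply: (coord_scalar_unique z0 (LM (spectral_prod (z :: ls)) V aV)) => {}phi.
  by rewrite -mulmxN VE mulmxDr H addr0 scalemxAr.
have [|||U aU UE] := IH (fun phi => (A - z%:M) *m V phi).
- by move=> w wl; apply: ls0; rewrite inE wl orbT.
- exact: coord_all_mulmx lin_closed_aa_functional aV.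
- move=> phi; rewrite mulmxA.
  have -> : spectral_prod ls *m (A - z%:M) = spectral_prod (z :: ls).
    rewrite /spectral_prod big_cons -/(spectral_prod ls).
    rewrite [RHS]mulmxBl mulmxBr comm_spectral_prod; congr (_ - _).
    by rewrite scalar_mxC.
  exact: PV.
exists (fun phi => V phi + U phi).
  exact: coord_allD lin_closed_aa_functional aV aU.
move=> phi; rewrite opprD VE UE mulmxBl mulmxDr mul_scalar_mx.
by apply/colP => i; rewrite !mxE; ring.
Qed.

(** The characteristic polynomial splits over the complex numbers; evaluating its factorization at
    [A] gives 0 by Cayley-Hamilton. *)
Lemma spectral_prod_root : exists2 ls : seq R[i],
  {in ls, forall z, eigenvalue A z} & spectral_prod ls = 0.
Proof.
have [ls E] := closed_field_poly_normal (char_poly A).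
rewrite (monicP (char_poly_monic A)) scale1r in E.
exists ls.
  move=> z zl; rewrite eigenvalue_root_char E root_prod_XsubC//.
have := Cayley_Hamilton A; rewrite E rmorph_prod /=.
under eq_bigr do rewrite rmorphB /= horner_mx_X horner_mx_C.
by [].
Qed.

End systems.

Theorem theorem4 (R : realType) (p : nat) (hp : (1 <= p)%N) (A : 'M[R[i]]_p)
    (S : 'I_p -> distrib R)
    (hS : forall i : 'I_p, almost_automorphic_distrib (S i))
    (hA : forall z : R[i], eigenvalue A z -> complex.Re z != 0) :
  exists U : 'I_p -> distrib R,
    [/\ forall i : 'I_p, bounded_distrib (U i),
        solves_linear_system A S U,
        (forall V : 'I_p -> distrib R,
          (forall i : 'I_p, bounded_distrib (V i)) ->
          solves_linear_system A S V ->
          forall (i : 'I_p) (phi : testfun R), V i phi = U i phi) &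
        forall i : 'I_p, almost_automorphic_distrib (U i)].
Proof.
move: A S hS hA; case: p hp => [//|n] _ A S hS hA.
have [ls lsA ls0] := spectral_prod_root A.
have lsRe : {in ls, forall z, complex.Re z != 0} by move=> z /lsA /hA.
have aS : coord_all (@aa_functional R) (fun phi => \col_i S i phi).
  move=> i; under eq_fun do rewrite mxE.
  by have [/bounded_distribP ? ?] := hS i.
(* Over the full list of roots the product is 0, so the annihilation hypothesis holds for any
   right-hand side. *)
have LS0 phi : spectral_prod A ls *m (\col_i S i phi : 'cV_n.+1) = 0.
  by rewrite ls0 mul0mx.
have [U aU UE] := system_solvable lsRe aS LS0.
have /choice[U' U'E] : forall i, exists T : distrib R,
    forall phi, T phi = U phi i 0.
  by move=> i; apply: L1_functional_distrib; have [] := aU i.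
have U'fE i : (U' i : testfun R -> R[i]) = (fun phi => U phi i 0).
  by apply/funext => phi; exact: U'E.
have aU' i : almost_automorphic_distrib (U' i).
  have [LU aaU] := aU i; split; last by rewrite U'fE.
  by apply/bounded_distribP; rewrite U'fE.
have U'S : solves_linear_system A S U'.
  move=> i phi; rewrite /distrib_derive U'fE.
  have /colP/(_ i) := UE phi; rewrite !mxE => ->; congr (_ + _).
  by apply: eq_bigr => j _; rewrite U'E.
exists U'; split=> // [i|V bV VS i phi]; first by case: (aU' i).
(* The difference of two bounded solutions solves the homogeneous system. *)
pose D phi : 'cV_n.+1 := \col_i (V i phi - U' i phi).
have D0 psi : D psi = 0.
  apply: (homogeneous_system_unique lsRe) => [j|chi|chi].
  - have [/bounded_distribP LU _] := aU' j; have /bounded_distribP LV := bV j.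
    rewrite (_ : (fun phi => D phi j 0) = (fun phi => -1 * U' j phi + V j phi)).
      exact: L1_functional_lin.
    by apply/funext => chi; rewrite mxE mulN1r addrC.
  - apply/colP => j; rewrite !mxE.
    have EU := U'S j chi; have EV := VS j chi.
    rewrite opprD -[X in X + _]/(distrib_derive (V j) chi) EV.
    rewrite -[X in _ - X]/(distrib_derive (U' j) chi) EU opprD addrACA subrr addr0.
    by rewrite -sumrB; apply: eq_bigr => k _; rewrite mxE mulrBr.
  - by rewrite ls0 mul0mx.
have /colP/(_ i) := D0 phi; rewrite !mxE => /eqP.
by rewrite subr_eq0 => /eqP.
Qed.
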